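(* For every real $\varepsilon>0$ and every $n\ge1$, $\varepsilon\text{-}\operatorname{Proj}^-_{\mathbb{R}^n}\equiv_{\mathrm{sW}}\operatorname{C}_\mathbb{R}$.
   Context: Represented spaces: a representation of a set $X$ is a partial surjection $\delta_X:\subseteq\mathbb{N}^\mathbb{N}\to X$. For a partial multi-valued function $f:\subseteq X\rightrightarrows Y$, a realizer is a partial $F:\subseteq\mathbb{N}^\mathbb{N}\to\mathbb{N}^\mathbb{N}$ with $\delta_Y(F(p))\in f(\delta_X(p))$ for all $p$ with $\delta_X(p)\in\mathrm{dom}(f)$. Strong Weihrauch reducibility $f\le_{\mathrm{sW}}g$: there are computable partial $H,K:\subseteq\mathbb{N}^\mathbb{N}\to\mathbb{N}^\mathbb{N}$ with $H\circ G\circ K$ a realizer of $f$ for every realizer $G$ of $g$; $\equiv_{\mathrm{sW}}$ means both directions. $\mathbb{R}^n$ has the Euclidean metric and the Cauchy representation (names are sequences $(q_i)$ in $\mathbb{Q}^n$ with $d(q_i,q_j)\le2^{-i}$ for $j\ge i$, naming the limit). Basic balls are open balls $B(c,r)$ with $c\in\mathbb{Q}^n$, $r$ a nonnegative rational. $\mathcal{A}_-(\mathbb{R}^n)$ (negative information): a name of a closed set $A$ enumerates basic balls whose union is $\mathbb{R}^n\setminus A$. For $\varepsilon>0$, $x\in\mathbb{R}^n$ and nonempty closed $A$, an $\varepsilon$-projection point of $x$ onto $A$ is $y\in A$ with $d(x,y)\le(1+\varepsilon)\,d(x,A)$. $\varepsilon\text{-}\operatorname{Proj}^-_{\mathbb{R}^n}:\subseteq\mathbb{R}^n\times\mathcal{A}_-(\mathbb{R}^n)\rightrightarrows\mathbb{R}^n$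 maps $(x,A)$, $A\ne\emptyset$, to the set of $\varepsilon$-projection points of $x$ onto $A$ ($\varepsilon$ is fixed, not part of the input). Closed choice $\operatorname{C}_\mathbb{R}:\subseteq\mathcal{A}_-(\mathbb{R})\rightrightarrows\mathbb{R}$ maps each nonempty closed $A\subseteq\mathbb{R}$ (negative information) to the set $A$. *)

(* Defs.v *)
From Stdlib Require Import Reals QArith Qabs Qreals List Arith ZArith.
Import ListNotations.
Set Implicit Arguments.

Local Open Scope nat_scope.
Definition Baire := nat -> nat.

Inductive recf : Type :=
| RZero
| RSucc
| RProj (i : nat)
| RComp (f : recf) (gs : list recf)
| RPrec (f g : recf)
| RMu (f : recf).

Inductive eval : recf -> list nat -> nat -> Prop :=
| eZero xs : eval RZero xs 0%nat
| eSucc xs : eval RSucc xs (S (hd 0%nat xs))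
| eProj i xs : eval (RProj i) xs (nth i xs 0%nat)
| eComp f gs xs ys y :
    Forall2 (fun g v => eval g xs v) gs ys -> eval f ys y -> eval (RComp f gs) xs y
| ePrec0 f g xs y : eval f xs y -> eval (RPrec f g) (0%nat :: xs) y
| ePrecS f g m xs r y :
    eval (RPrec f g) (m :: xs) r -> eval g (m :: r :: xs) y ->
    eval (RPrec f g) (S m :: xs) y
| eMu f xs y :
    eval f (y :: xs) 0%nat ->
    (forall z, z < y -> exists v, eval f (z :: xs) (S v)) ->
    eval (RMu f) xs y.

Definition computable_nat (a : nat -> nat) : Prop :=
  exists r : recf, forall x, eval r [x] (a x).

Definition cpair (x y : nat) : nat := (x + y) * (x + y + 1) / 2 + y.

Definition cunpair (z : nat) : nat * nat :=
  let w := (Nat.sqrt (8 * z + 1) - 1) / 2 in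
  let t := w * (w + 1) / 2 in
  let y := z - t in (w - y, y).

Fixpoint code_list (l : list nat) : nat :=
  match l with [] => 0 | x :: l' => S (cpair x (code_list l')) end.

Fixpoint decode_list_fuel (fuel z : nat) : list nat :=
  match fuel with
  | 0 => []
  | S f => match z with
           | 0 => []
           | S z' => let (x, r) := cunpair z' in x :: decode_list_fuel f r
           end
  end.

Definition decode_list (z : nat) : list nat := decode_list_fuel z z.

Definition prefix (p : Baire) (k : nat) : list nat := map p (seq 0 k).

(* alpha is an associate of a (partial) map sending p to q:
   alpha(<n, p[0..k)>) is either 0 ("no answer yet") or q(n)+1, and
   eventually it is q(n)+1. *)
Definition associate (alpha : nat -> nat) (p q : Baire) : Prop :=
  forall n,
    (exists k, alpha (cpair n (code_list (prefix p k))) = S (q n)) /\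
    (forall k m, alpha (cpair n (code_list (prefix p k))) = S m -> m = q n).

Definition pfun := Baire -> option Baire.

Definition computable_pfun (F : pfun) : Prop :=
  exists alpha, computable_nat alpha /\
    forall p q, F p = Some q -> associate alpha p q.

Definition pcomp (H G : pfun) : pfun :=
  fun p => match G p with Some q => H q | None => None end.

Record mvf (X Y : Type) := MVF { mdom : X -> Prop; mval : X -> Y -> Prop }.

(* a representation is given by its "p names x" relation *)
Definition realizer {X Y : Type} (dX : Baire -> X -> Prop) (dY : Baire -> Y -> Prop)
  (f : mvf X Y) (F : pfun) : Prop :=
  forall p x, dX p x -> mdom f x ->
    exists q, F p = Some q /\ exists y, dY q y /\ mval f x y.

Definition sW_le {X Y Z W : Type}
  (dX : Baire -> X -> Prop) (dY : Baire -> Y -> Prop) (f : mvf X Y)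
  (dZ : Baire -> Z -> Prop) (dW : Baire -> W -> Prop) (g : mvf Z W) : Prop :=
  exists H K : pfun, computable_pfun H /\ computable_pfun K /\
    forall G : pfun, realizer dZ dW g G -> realizer dX dY f (pcomp H (pcomp G K)).

Definition sW_equiv {X Y Z W : Type}
  (dX : Baire -> X -> Prop) (dY : Baire -> Y -> Prop) (f : mvf X Y)
  (dZ : Baire -> Z -> Prop) (dW : Baire -> W -> Prop) (g : mvf Z W) : Prop :=
  sW_le dX dY f dZ dW g /\ sW_le dZ dW g dX dY f.

Definition names_prod {X Y : Type} (dX : Baire -> X -> Prop) (dY : Baire -> Y -> Prop)
  (p : Baire) (xy : X * Y) : Prop :=
  dX (fun i => p (2 * i)) (fst xy) /\ dY (fun i => p (2 * i + 1)) (snd xy).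

Definition decZ (a : nat) : Z :=
  if Nat.even a then Z.of_nat (Nat.div2 a) else (- Z.of_nat (Nat.div2 (S a)))%Z.

Definition decQ (k : nat) : Q :=
  let (a, b) := cunpair k in Qmake (decZ a) (Pos.of_succ_nat b).

(* standard enumeration of Q^n (coordinates i < n are the relevant ones) *)
Definition decQv (k : nat) : nat -> R :=
  fun i => Q2R (decQ (nth i (decode_list k) 0)).

Close Scope nat_scope.
Open Scope R_scope.

Definition Rn (n : nat) : Type := { x : nat -> R | forall i, (n <= i)%nat -> x i = 0 }.

Fixpoint sumR (n : nat) (f : nat -> R) : R :=
  match n with O => 0 | S m => sumR m f + f m end.

Definition distn (n : nat) (u v : nat -> R) : R :=
  sqrt (sumR n (fun i => (u i - v i) ^ 2)).

Definition names_Rn (n : nat) (p : Baire) (x : Rn n) : Prop :=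
  (forall i j, (i <= j)%nat -> distn n (decQv (p i)) (decQv (p j)) <= (/ 2) ^ i) /\
  (forall e, 0 < e -> exists N, forall i, (N <= i)%nat ->
      distn n (decQv (p i)) (proj1_sig x) < e).

Definition ball_center_n (k : nat) : nat -> R := decQv (fst (cunpair k)).
Definition ball_radius (k : nat) : R := Q2R (Qabs (decQ (snd (cunpair k)))).

Definition names_An (n : nat) (p : Baire) (A : Rn n -> Prop) : Prop :=
  forall x : Rn n,
    A x <-> ~ (exists i, distn n (ball_center_n (p i)) (proj1_sig x) < ball_radius (p i)).

Definition names_R (p : Baire) (x : R) : Prop :=
  (forall i j, (i <= j)%nat -> Rabs (Q2R (decQ (p i)) - Q2R (decQ (p j))) <= (/ 2) ^ i) /\
  (forall e, 0 < e -> exists N, forall i, (N <= i)%nat ->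
      Rabs (Q2R (decQ (p i)) - x) < e).

Definition ball_center_R (k : nat) : R := Q2R (decQ (fst (cunpair k))).

Definition names_AR (p : Baire) (A : R -> Prop) : Prop :=
  forall x : R,
    A x <-> ~ (exists i, Rabs (ball_center_R (p i) - x) < ball_radius (p i)).

Definition is_inf (S : R -> Prop) (m : R) : Prop :=
  (forall s, S s -> m <= s) /\ (forall m', (forall s, S s -> m' <= s) -> m' <= m).

Definition dist_set_is (n : nat) (x : Rn n) (A : Rn n -> Prop) (m : R) : Prop :=
  is_inf (fun s => exists a, A a /\ s = distn n (proj1_sig x) (proj1_sig a)) m.

Definition eps_Proj (eps : R) (n : nat) : mvf (Rn n * (Rn n -> Prop)) (Rn n) :=
  MVF (fun xA : Rn n * (Rn n -> Prop) => exists a, snd xA a)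
      (fun xA y => snd xA y /\
         exists m, dist_set_is (fst xA) (snd xA) m /\
           distn n (proj1_sig (fst xA)) (proj1_sig y) <= (1 + eps) * m).

Definition C_R : mvf (R -> Prop) R :=
  MVF (fun A : R -> Prop => exists a, A a) (fun A y => A y).

Arguments names_Rn n p x : clear implicits.
Arguments names_An n p A : clear implicits.

(* Main.v *)
(* For C_R <= Proj, project the origin onto the cylinder A x R^(n-1): its first coordinate is a
   point of A.

   For Proj <= C_R, a point r of the instance of C_R codes a guess k followed by the bits of a
   point y of R^n.  The guess names a rational a, a stage s, and the corner of a unit cube
   containing y.  The point r is kept as long as y passes the following tests, each decidable at
   a finite precision and jointly a closed condition: y avoids all balls enumerated outside A;
   d(x, y) <= c a for a fixed rational 1 < c <= 1 + eps; and, if a > 0, the balls enumerated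
   before stage s cover the closed ball of radius a around x, which forces a <= d(x, A).  Any
   surviving y is then an eps-projection.  Conversely a guess exists: if d(x, A) > 0, take a
   slightly below d(x, A) and let compactness supply s; otherwise take a = 0 and y = x.

   Working in base beta = 2^(n+2) with all digits in [beta/4, beta/2) keeps beta^t r in
   [N + 1/4, N + 3/4] for an integer N at every level t, so that N, hence y, can be read off
   continuously from r alone. *)

(* The obstacle is that negative information on A only yields lower bounds on the distance:
   [a < d(x, A)] is confirmed at a finite stage, an upper bound never is. Hence the upper bound is
   carried by y itself, as the closed condition [d(x, y) <= c a], and the lower bound by a guessed
   stage, whose correctness is decided once and for all. The gap between 1 and c makes room for a
   rational a; at distance 0 there is no such room, but there the projection is forced to be x.
   Since the reduction is strong, the outer program sees a name of the real r but neither x nor A,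
   so r has to carry all of y. It sees r only through approximations, from which a floor is not
   computable in general; the margins of 1/4 on both sides of each cell remove this discontinuity.
   The number eps may be noncomputable; only the rational c enters the programs. *)
Require Import Defs.
From Stdlib Require Import Reals QArith Qabs Qreals List Arith ZArith Lia Lra.
From Stdlib Require Import Classical ClassicalEpsilon.
Import ListNotations.
Open Scope nat_scope.

(** * Recursive functions of an environment *)

(* [v] is an infinite environment of which [f] may only read a bounded part; the arity is left
   free above [k0] so that functions can be combined without bookkeeping. *)
Definition recur (f : (nat -> nat) -> nat) : Prop :=
  exists k0, forall k, k0 <= k -> exists r, forall v, eval r (prefix v k) (f v).

Definition recurb (f : (nat -> nat) -> bool) : Prop := recur (fun v => Nat.b2n (f v)).

Lemma prefix_S v k : prefix v (S k) = prefix v k ++ [v k].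
Proof. unfold prefix. now rewrite seq_S, map_app. Qed.

Lemma nth_prefix v k i : i < k -> nth i (prefix v k) 0 = v i.
Proof.
  intros H. unfold prefix. rewrite nth_indep with (d' := v 0).
  - rewrite map_nth, seq_nth; auto.
  - now rewrite length_map, length_seq.
Qed.

Lemma length_prefix v k : length (prefix v k) = k.
Proof. unfold prefix. now rewrite length_map, length_seq. Qed.

Definition scons (m : nat) (v : nat -> nat) : nat -> nat :=
  fun i => match i with 0 => m | S j => v j end.

Lemma prefix_scons m v k : prefix (scons m v) (S k) = m :: prefix v k.
Proof. unfold prefix. simpl. f_equal. rewrite <- seq_shift, map_map. reflexivity. Qed.

Lemma recur_ext f g : (forall v, f v = g v) -> recur g -> recur f.
Proof.
  intros E [k0 H]. exists k0. intros k Hk. destruct (H k Hk) as [r Hr].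
  exists r. intros v. rewrite E. apply Hr.
Qed.

Lemma recur_var i : recur (fun v => v i).
Proof.
  exists (S i). intros k Hk. exists (RProj i). intros v.
  rewrite <- (nth_prefix v k i) by lia. constructor.
Qed.

(** Only finitely many components of [s v] are read, so finitely many programs suffice and their
    arity thresholds can be added up. *)
Lemma recur_subst f (s : (nat -> nat) -> nat -> nat) :
  recur f -> (forall i, recur (fun v => s v i)) -> recur (fun v => f (s v)).
Proof.
  intros [k0 Hf] Hs. destruct (Hf k0 (le_n _)) as [r Hr].
  assert (G : exists k1, forall k, k1 <= k -> exists gs, forall v,
    Forall2 (fun g y => eval g (prefix v k) y) gs (prefix (s v) k0)).
  { clear Hf Hr. induction k0 as [|m [k1 IH]].
    - exists 0. intros k _. exists []. intros v. constructor.
    - destruct (Hs m) as [k2 H2]. exists (k1 + k2). intros k Hk.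
      destruct (IH k) as [gs Hgs]; [lia|]. destruct (H2 k) as [g Hg]; [lia|].
      exists (gs ++ [g]). intros v. rewrite prefix_S.
      apply Forall2_app; auto. }
  destruct G as [k1 G]. exists k1. intros k Hk. destruct (G k Hk) as [gs Hgs].
  exists (RComp r gs). intros v. econstructor; [apply Hgs | apply Hr].
Qed.

Lemma recur_S f : recur f -> recur (fun v => S (f v)).
Proof.
  intros [k0 H]. exists k0. intros k Hk. destruct (H k Hk) as [r Hr].
  exists (RComp RSucc [r]). intros v. apply eComp with [f v].
  - constructor; auto.
  - apply (eSucc [f v]).
Qed.

Lemma recur_const c : recur (fun _ => c).
Proof.
  induction c as [|c IH]; [|now apply recur_S].
  exists 0. intros k _. exists RZero. constructor.
Qed.

Lemma recur_rec f (g : nat -> nat -> (nat -> nat) -> nat) h :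
  recur f -> recur (fun w => g (w 0) (w 1) (fun i => w (S (S i)))) -> recur h ->
  recur (fun v => nat_rect (fun _ => nat) (f v) (fun m r => g m r v) (h v)).
Proof.
  intros [kf Hf] [kg Hg] [kh Hh]. exists (kf + kg + kh). intros k Hk.
  destruct (Hf k) as [rf Rf]; [lia|]. destruct (Hg (S (S k))) as [rg Rg]; [lia|].
  destruct (Hh k) as [rh Rh]; [lia|].
  exists (RComp (RPrec rf rg) (rh :: map RProj (seq 0 k))). intros v.
  apply eComp with (h v :: prefix v k).
  - constructor; auto.
    assert (G : forall l, (forall i, In i l -> i < k) ->
      Forall2 (fun g y => eval g (prefix v k) y) (map RProj l) (map v l)).
    { induction l as [|i l IH]; simpl; constructor.
      - rewrite <- (nth_prefix v k i) by auto. constructor.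
      - apply IH. auto. }
    apply G. intros i Hi. apply in_seq in Hi. lia.
  - generalize (h v) as n. induction n as [|n IH]; simpl.
    + constructor. auto.
    + econstructor; [exact IH|].
      rewrite <- !prefix_scons.
      exact (Rg (scons n (scons _ v))).
Qed.

(** The arity that the witness may require is met by padding the argument with zeros, each computed
    by [RZero]. *)
Lemma computable_of_recur (a : nat -> nat) : recur (fun v => a (v 0)) -> computable_nat a.
Proof.
  intros [k0 H]. destruct (H (S k0)) as [r Hr]; [lia|].
  exists (RComp r (RProj 0 :: repeat RZero k0)). intros x.
  apply eComp with (prefix (scons x (fun _ => 0)) (S k0)).
  - rewrite prefix_scons. constructor; [apply (eProj 0 [x])|].
    unfold prefix. generalize 0 at 2. clear. induction k0 as [|k IH]; intros s; simpl;
    constructor; auto.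
    constructor.
  - apply (Hr (scons x (fun _ => 0))).
Qed.

Create HintDb recur discriminated.
#[export] Hint Constants Opaque : recur.
#[export] Hint Resolve recur_var recur_S recur_const : recur.

Lemma recur_app1 F a : recur (fun v => F (v 0)) -> recur a -> recur (fun v => F (a v)).
Proof.
  intros HF Ha. apply (recur_subst (fun v => F (v 0)) (fun v => scons (a v) v)); auto.
  intros [|i]; simpl; auto with recur.
Qed.

Lemma recur_app2 F a b : recur (fun v => F (v 0) (v 1)) -> recur a -> recur b ->
  recur (fun v => F (a v) (b v)).
Proof.
  intros HF Ha Hb.
  apply (recur_subst (fun v => F (v 0) (v 1)) (fun v => scons (a v) (scons (b v) v))); auto.
  intros [|[|i]]; simpl; auto with recur.
Qed.

Ltac recur := cbn beta iota delta [scons]; solve [auto 60 with recur].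

(** * Closure under arithmetic and Boolean operations *)

Lemma recur_pred a : recur a -> recur (fun v => Nat.pred (a v)).
Proof.
  intros Ha. apply (recur_app1 Nat.pred); auto.
  apply recur_ext with (fun v => nat_rect (fun _ => nat) 0 (fun m _ => m) (v 0)).
  - intros v. now destruct (v 0).
  - apply (recur_rec _ (fun m _ _ => m)); recur.
Qed.
#[export] Hint Resolve recur_pred : recur.

Lemma recur_add a b : recur a -> recur b -> recur (fun v => a v + b v).
Proof.
  intros Ha Hb.
  apply recur_ext with (fun v => nat_rect (fun _ => nat) (b v) (fun _ r => S r) (a v)).
  - intros v. induction (a v); simpl; congruence.
  - apply (recur_rec _ (fun _ r _ => S r)); recur.
Qed.

Lemma recur_sub a b : recur a -> recur b -> recur (fun v => a v - b v).
Proof.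
  intros Ha Hb.
  apply recur_ext with (fun v => nat_rect (fun _ => nat) (a v) (fun _ r => Nat.pred r) (b v)).
  - intros v. induction (b v); simpl; lia.
  - apply (recur_rec _ (fun _ r _ => Nat.pred r)); recur.
Qed.
#[export] Hint Resolve recur_add recur_sub : recur.

Lemma recur_mul a b : recur a -> recur b -> recur (fun v => a v * b v).
Proof.
  intros Ha Hb. apply (recur_app2 Nat.mul); auto.
  apply recur_ext with (fun v => nat_rect (fun _ => nat) 0 (fun _ r => v 1 + r) (v 0)).
  - intros v. induction (v 0); simpl; congruence.
  - apply (recur_rec _ (fun _ r v => v 1 + r)); recur.
Qed.
#[export] Hint Resolve recur_mul : recur.

Lemma recur_pow a b : recur a -> recur b -> recur (fun v => a v ^ b v).
Proof.
  intros Ha Hb. apply (recur_app2 Nat.pow); auto.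
  apply recur_ext with (fun v => nat_rect (fun _ => nat) 1 (fun _ r => v 0 * r) (v 1)).
  - intros v. induction (v 1); simpl; congruence.
  - apply (recur_rec _ (fun _ r v => v 0 * r)); recur.
Qed.
#[export] Hint Resolve recur_pow : recur.

Lemma recur_b2n b : recurb b -> recur (fun v => Nat.b2n (b v)).
Proof. auto. Qed.

Lemma recurb_leb a b : recur a -> recur b -> recurb (fun v => a v <=? b v).
Proof.
  intros Ha Hb. apply recur_ext with (fun v => 1 - (a v - b v)); [|recur].
  intros v. destruct (Nat.leb_spec (a v) (b v)); unfold Nat.b2n; lia.
Qed.

Lemma recurb_ltb a b : recur a -> recur b -> recurb (fun v => a v <? b v).
Proof. intros Ha Hb. apply (recurb_leb (fun v => S (a v))); recur. Qed.

Lemma recurb_negb a : recurb a -> recurb (fun v => negb (a v)).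
Proof.
  intros Ha. apply recur_ext with (fun v => 1 - Nat.b2n (a v)); [|recur].
  intros v. now destruct (a v).
Qed.

Lemma recurb_andb a b : recurb a -> recurb b -> recurb (fun v => a v && b v)%bool.
Proof.
  intros Ha Hb. apply recur_ext with (fun v => Nat.b2n (a v) * Nat.b2n (b v)); [|recur].
  intros v. now destruct (a v), (b v).
Qed.

Lemma recurb_orb a b : recurb a -> recurb b -> recurb (fun v => a v || b v)%bool.
Proof.
  intros Ha Hb.
  apply recur_ext with (fun v => 1 - (1 - Nat.b2n (a v)) * (1 - Nat.b2n (b v))); [|recur].
  intros v. now destruct (a v), (b v).
Qed.

Lemma recur_if (c : (nat -> nat) -> bool) a b :
  recurb c -> recur a -> recur b -> recur (fun v => if c v then a v else b v).
Proof.
  intros Hc Ha Hb.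
  apply recur_ext with (fun v => Nat.b2n (c v) * a v + (1 - Nat.b2n (c v)) * b v); [|recur].
  intros v. destruct (c v); unfold Nat.b2n; lia.
Qed.
#[export] Hint Resolve recur_b2n recurb_leb recurb_ltb recurb_negb recurb_andb recurb_orb recur_if
  : recur.

(** * Bounded counting and bounded quantification *)

Fixpoint count (P : nat -> bool) (b : nat) : nat :=
  match b with 0 => 0 | S b' => Nat.b2n (P b') + count P b' end.

(** Quotients and square roots are the number of i passing a monotone test, so counting yields them
    by primitive recursion alone. *)
Lemma count_threshold P b q : q <= b -> (forall i, i < b -> P i = (i <? q)) -> count P b = q.
Proof.
  intros Hq H. assert (G : forall c, c <= b -> count P c = Nat.min c q).
  { induction c as [|c IH]; intros Hc; [simpl; lia|]; cbn [count].
    rewrite H, IH by lia. destruct (Nat.ltb_spec c q); unfold Nat.b2n; lia. }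
  rewrite G; lia.
Qed.

Lemma recur_count (P : nat -> (nat -> nat) -> bool) h :
  recurb (fun w => P (w 0) (fun i => w (S i))) -> recur h ->
  recur (fun v => count (fun i => P i v) (h v)).
Proof.
  intros HP Hh.
  apply recur_ext with
    (fun v => nat_rect (fun _ => nat) 0 (fun m r => Nat.b2n (P m v) + r) (h v)).
  - intros v. induction (h v); simpl; congruence.
  - apply (recur_rec _ (fun m r v => Nat.b2n (P m v) + r)); auto with recur.
    apply recur_add; [|recur].
    apply (recur_subst (fun w => Nat.b2n (P (w 0) (fun i => w (S i))))
      (fun w => scons (w 0) (fun i => w (S (S i))))); auto.
    intros [|i]; recur.
Qed.

Fixpoint ballb (b : nat) (P : nat -> bool) : bool :=
  match b with 0 => true | S b' => (P b' && ballb b' P)%bool end.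

Lemma ballb_spec b P : ballb b P = true <-> forall i, i < b -> P i = true.
Proof.
  induction b as [|b IH]; simpl.
  - split; auto. intros _ i H. lia.
  - rewrite Bool.andb_true_iff, IH. split.
    + intros [H1 H2] i Hi. destruct (Nat.eq_dec i b); subst; auto. apply H2. lia.
    + intros H. split; auto.
Qed.

Lemma recurb_ballb (P : nat -> (nat -> nat) -> bool) h :
  recur h -> recurb (fun w => P (w 0) (fun i => w (S i))) ->
  recurb (fun v => ballb (h v) (fun i => P i v)).
Proof.
  intros Hh HP.
  apply recur_ext with (fun v => 1 - count (fun i => negb (P i v)) (h v)).
  - intros v. induction (h v) as [|b IH]; simpl; auto.
    destruct (P b v); simpl; auto.
  - apply recur_sub; [recur|]. apply (recur_count (fun i v => negb (P i v))); auto with recur.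
Qed.

Lemma recur_div a b : recur a -> recur b -> recur (fun v => a v / b v).
Proof.
  intros Ha Hb. apply (recur_app2 Nat.div); auto.
  apply recur_ext with (fun v => if 1 <=? v 1 then count (fun i => S i * v 1 <=? v 0) (v 0) else 0).
  - intros v. generalize (v 0) (v 1). intros x y. destruct (Nat.leb_spec 1 y) as [H|H].
    + symmetry. apply count_threshold.
      * apply Nat.Div0.div_le_upper_bound. nia.
      * intros i _. destruct (Nat.ltb_spec i (x / y)) as [L|L].
        -- apply Nat.leb_le. pose proof (Nat.Div0.mul_div_le x y). nia.
        -- apply Nat.leb_gt. pose proof (Nat.mul_succ_div_gt x y ltac:(lia)). nia.
    + replace y with 0 by lia. reflexivity.
  - apply recur_if; auto with recur.
    apply (recur_count (fun i v => S i * v 1 <=? v 0)); recur.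
Qed.

Lemma recur_sqrt a : recur a -> recur (fun v => Nat.sqrt (a v)).
Proof.
  intros Ha. apply (recur_app1 Nat.sqrt); auto.
  apply recur_ext with (fun v => count (fun i => S i * S i <=? v 0) (v 0)).
  - intros v. generalize (v 0). intros x. symmetry. apply count_threshold.
    + apply Nat.sqrt_le_lin.
    + intros i _. pose proof (Nat.sqrt_spec x ltac:(lia)).
      destruct (Nat.ltb_spec i (Nat.sqrt x)); [apply Nat.leb_le|apply Nat.leb_gt]; nia.
  - apply (recur_count (fun i v => S i * S i <=? v 0)); recur.
Qed.
#[export] Hint Resolve recur_div recur_sqrt : recur.

Lemma recur_mod a b : recur a -> recur b -> recur (fun v => a v mod b v).
Proof.
  intros Ha Hb. apply recur_ext with (fun v => a v - b v * (a v / b v)); [|recur].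
  intros v. pose proof (Nat.div_mod_eq (a v) (b v)). lia.
Qed.
#[export] Hint Resolve recur_mod : recur.

Lemma recur_cpair a b : recur a -> recur b -> recur (fun v => cpair (a v) (b v)).
Proof. intros Ha Hb. unfold cpair. auto 20 with recur. Qed.

Lemma recur_fst_cunpair a : recur a -> recur (fun v => fst (cunpair (a v))).
Proof. intros Ha. cbv beta zeta iota delta [cunpair fst]. auto 40 with recur. Qed.

Lemma recur_snd_cunpair a : recur a -> recur (fun v => snd (cunpair (a v))).
Proof. intros Ha. cbv beta zeta iota delta [cunpair snd]. auto 40 with recur. Qed.
#[export] Hint Resolve recur_cpair recur_fst_cunpair recur_snd_cunpair : recur.

(** With [s = x + y] and the triangular number [t = s (s + 1) / 2], the radicand [8 (t + y) + 1]
    equals [(2 s + 1)^2 + 8 y], which is below [(2 s + 3)^2] because [y <= s]; its root therefore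
    determines s. *)
Lemma cunpair_cpair x y : cunpair (cpair x y) = (x, y).
Proof.
  unfold cunpair, cpair. set (s := x + y).
  assert (Hs : exists t, s * (s + 1) = 2 * t).
  { destruct (Nat.Even_or_Odd s) as [[m E]|[m E]].
    - exists (m * (s + 1)). nia.
    - exists (s * (m + 1)). nia. }
  destruct Hs as [t Ht]. rewrite Ht.
  replace (2 * t / 2) with t by (rewrite Nat.mul_comm, Nat.div_mul; lia).
  assert (Q : 2 * s + 1 <= Nat.sqrt (8 * (t + y) + 1) < 2 * s + 3).
  { split.
    - apply Nat.sqrt_le_square. nia.
    - apply Nat.sqrt_lt_square. nia. }
  replace ((Nat.sqrt (8 * (t + y) + 1) - 1) / 2) with s.
  2:{ apply Nat.div_unique with ((Nat.sqrt (8 * (t + y) + 1) - 1) - 2 * s); lia. }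
  rewrite Ht. replace (2 * t / 2) with t by (rewrite Nat.mul_comm, Nat.div_mul; lia).
  f_equal; lia.
Qed.

(** * Codes of finite lists, and functionals reading finite prefixes *)

Arguments cunpair : simpl never.
Arguments cpair : simpl never.

(** Access by iterated tails is visibly primitive recursive, unlike decoding with fuel. The empty
    list has code 0, and 0 unpairs to [(0, 0)], so reading past the end returns 0, the default used
    with [nth]. *)
Definition ctl (c : nat) : nat := snd (cunpair (Nat.pred c)).
Definition ent (c j : nat) : nat := fst (cunpair (Nat.pred (Nat.iter j ctl c))).

Lemma recur_iter_ctl c j : recur c -> recur j -> recur (fun v => Nat.iter (j v) ctl (c v)).
Proof.
  intros Hc Hj. apply (recur_rec _ (fun _ r _ => ctl r)); auto. unfold ctl. recur.
Qed.
#[export] Hint Resolve recur_iter_ctl : recur.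

Lemma recur_ent c j : recur c -> recur j -> recur (fun v => ent (c v) (j v)).
Proof. intros Hc Hj. unfold ent. auto with recur. Qed.
#[export] Hint Resolve recur_ent : recur.

Lemma iter_ctl_code l j : Nat.iter j ctl (code_list l) = code_list (skipn j l).
Proof.
  induction j as [|j IH]; [reflexivity|].
  change (Nat.iter (S j) ctl (code_list l)) with (ctl (Nat.iter j ctl (code_list l))). rewrite IH.
  replace (skipn (S j) l) with (tl (skipn j l)).
  - destruct (skipn j l); unfold ctl; cbn [code_list Nat.pred tl]; [reflexivity|].
    now rewrite cunpair_cpair.
  - clear IH. revert l. induction j; intros [|x l]; simpl; auto.
Qed.

Lemma ent_code_list l j : ent (code_list l) j = nth j l 0.
Proof.
  unfold ent. rewrite iter_ctl_code.
  rewrite <- (Nat.add_0_r j) at 2. rewrite <- nth_skipn.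
  destruct (skipn j l); cbn [code_list Nat.pred nth]; [reflexivity|].
  now rewrite cunpair_cpair.
Qed.

Lemma decode_list_ent c j : nth j (decode_list c) 0 = ent c j.
Proof.
  assert (Z : forall i, Nat.iter i ctl 0 = 0) by (induction i as [|i E]; simpl; [|rewrite E]; auto).
  unfold decode_list. assert (G : forall f z i, z <= f -> nth i (decode_list_fuel f z) 0 = ent z i).
  { induction f as [|f IH]; intros z i Hz.
    - replace z with 0 by lia. unfold ent. rewrite Z. now destruct i.
    - destruct z as [|z]; cbn [decode_list_fuel].
      + unfold ent. rewrite Z. now destruct i.
      + destruct (cunpair z) as [x r] eqn:E. destruct i as [|i]; simpl nth.
        * change (ent (S z) 0) with (fst (cunpair z)). now rewrite E.
        * rewrite IH.
          -- unfold ent. f_equal. f_equal. f_equal. rewrite Nat.iter_succ_r.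
             change (ctl (S z)) with (snd (cunpair z)). now rewrite E.
          -- assert (r = snd (cunpair z)) by now rewrite E.
          cbv beta zeta iota delta [cunpair snd] in H. lia. }
  now apply G.
Qed.

Lemma decQv_ent k i : decQv k i = Q2R (decQ (ent k i)).
Proof. unfold decQv. now rewrite decode_list_ent. Qed.

Definition has_length_S (c n : nat) : bool :=
  ((1 <=? Nat.iter n ctl c) && (Nat.iter (S n) ctl c <=? 0))%bool.

Lemma has_length_S_code l n : has_length_S (code_list l) n = (length l =? S n).
Proof.
  unfold has_length_S. rewrite !iter_ctl_code.
  assert (L : forall j, (1 <=? code_list (skipn j l)) = (j <? length l)).
  { intros j. pose proof (length_skipn j l) as L.
    destruct (skipn j l); simpl in L |- *; symmetry;
      [apply Nat.ltb_ge|apply Nat.ltb_lt]; lia. }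
  rewrite L. replace (code_list (skipn (S n) l) <=? 0) with (negb (S n <? length l)).
  2:{ rewrite <- L. now destruct (code_list _). }
  destruct (Nat.ltb_spec n (length l)), (Nat.ltb_spec (S n) (length l)),
    (Nat.eqb_spec (length l) (S n)); simpl; auto; lia.
Qed.

(** The associate answers query m on the prefix of length exactly [S (u m)] and is silent on all
    other prefixes, which makes its answers consistent. *)
Lemma computable_functional f u :
  recur (fun v => f (v 0) (v 1)) -> recur (fun v => u (v 0)) ->
  computable_pfun (fun p => Some (fun m => f m (code_list (prefix p (S (u m)))))).
Proof.
  intros Hf Hu.
  exists (fun z => if has_length_S (snd (cunpair z)) (u (fst (cunpair z)))
    then S (f (fst (cunpair z)) (snd (cunpair z))) else 0).
  split.
  - apply computable_of_recur.
    assert (Hu' : recur (fun v => u (fst (cunpair (v 0))))) by (apply (recur_app1 u);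
    auto with recur).
    apply recur_if; unfold has_length_S; auto 20 with recur.
    apply recur_S. apply (recur_app2 f); auto with recur.
  - intros p q [= <-] m.
    split.
    + exists (S (u m)). rewrite cunpair_cpair. cbn [fst snd].
      now rewrite has_length_S_code, length_prefix, Nat.eqb_refl.
    + intros k x. rewrite cunpair_cpair. cbn [fst snd].
      rewrite has_length_S_code, length_prefix.
      destruct (Nat.eqb_spec k (S (u m))) as [->|]; [now intros [= <-]|discriminate].
Qed.

(** * Arithmetic on codes of rationals *)

(* [decZ a = zpos a - zneg a]: signed numbers are handled as differences of naturals. *)
Definition zpos (a : nat) : nat := if a mod 2 <=? 0 then a / 2 else 0.
Definition zneg (a : nat) : nat := if a mod 2 <=? 0 then 0 else S a / 2.
Definition zmk (p n : nat) : nat := if n <=? p then 2 * (p - n) else 2 * (n - p) - 1.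

Definition qp (k : nat) : nat := zpos (fst (cunpair k)).
Definition qn (k : nat) : nat := zneg (fst (cunpair k)).
Definition qd (k : nat) : nat := S (snd (cunpair k)).
Definition qmk (p n d : nat) : nat := cpair (zmk p n) (Nat.pred d).

Definition qfrac (p d : nat) : nat := qmk p 0 d.
Definition qadd (a b : nat) : nat :=
  qmk (qp a * qd b + qp b * qd a) (qn a * qd b + qn b * qd a) (qd a * qd b).
Definition qsub (a b : nat) : nat :=
  qmk (qp a * qd b + qn b * qd a) (qn a * qd b + qp b * qd a) (qd a * qd b).
Definition qmul (a b : nat) : nat :=
  qmk (qp a * qp b + qn a * qn b) (qp a * qn b + qn a * qp b) (qd a * qd b).
Definition qabs (a : nat) : nat := qmk (qp a + qn a) 0 (qd a).
Definition qltb (a b : nat) : bool :=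
  qp a * qd b + qn b * qd a <? qp b * qd a + qn a * qd b.
Definition qfloor (a : nat) : nat := (qp a - qn a) / qd a.

Section ComputableRationals.
Variables a b c : (nat -> nat) -> nat.
Hypotheses (Ha : recur a) (Hb : recur b) (Hc : recur c).

Lemma recur_qp : recur (fun v => qp (a v)).
Proof. unfold qp, zpos. auto 20 with recur. Qed.

Lemma recur_qn : recur (fun v => qn (a v)).
Proof. unfold qn, zneg. auto 20 with recur. Qed.

Lemma recur_qd : recur (fun v => qd (a v)).
Proof. unfold qd. auto 20 with recur. Qed.

Lemma recur_qmk : recur (fun v => qmk (a v) (b v) (c v)).
Proof. unfold qmk, zmk. auto 20 with recur. Qed.
End ComputableRationals.
#[export] Hint Resolve recur_qp recur_qn recur_qd recur_qmk : recur.

Section ComputableRationalArithmetic.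
Variables a b : (nat -> nat) -> nat.
Hypotheses (Ha : recur a) (Hb : recur b).

Lemma recur_qfrac : recur (fun v => qfrac (a v) (b v)).
Proof. unfold qfrac. auto 20 with recur. Qed.

Lemma recur_qadd : recur (fun v => qadd (a v) (b v)).
Proof. unfold qadd. auto 20 with recur. Qed.

Lemma recur_qsub : recur (fun v => qsub (a v) (b v)).
Proof. unfold qsub. auto 20 with recur. Qed.

Lemma recur_qmul : recur (fun v => qmul (a v) (b v)).
Proof. unfold qmul. auto 20 with recur. Qed.

Lemma recur_qabs : recur (fun v => qabs (a v)).
Proof. unfold qabs. auto 20 with recur. Qed.

Lemma recurb_qltb : recurb (fun v => qltb (a v) (b v)).
Proof. unfold qltb. auto 20 with recur. Qed.

Lemma recur_qfloor : recur (fun v => qfloor (a v)).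
Proof. unfold qfloor. auto 20 with recur. Qed.
End ComputableRationalArithmetic.
#[export] Hint Resolve recur_qfrac recur_qadd recur_qsub recur_qmul recur_qabs recurb_qltb
  recur_qfloor
  : recur.

Open Scope R_scope.
Definition qv (k : nat) : R := Q2R (decQ k).

Lemma decZ_diff a : decZ a = (Z.of_nat (zpos a) - Z.of_nat (zneg a))%Z.
Proof.
  unfold decZ, zpos, zneg. rewrite !Nat.div2_div.
  pose proof (Nat.div_mod_eq a 2) as E.
  pose proof (Nat.mod_upper_bound a 2 ltac:(lia)) as U.
  destruct (Nat.even a) eqn:Ev.
  - apply Nat.even_spec in Ev. destruct Ev as [m ->].
    destruct (Nat.leb_spec (2 * m mod 2) 0); lia.
  - rewrite <- Nat.negb_odd in Ev. apply Bool.negb_false_iff, Nat.odd_spec in Ev.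
    destruct Ev as [m ->].
    destruct (Nat.leb_spec ((2 * m + 1) mod 2) 0); lia.
Qed.

Lemma decZ_zmk p n : decZ (zmk p n) = (Z.of_nat p - Z.of_nat n)%Z.
Proof.
  unfold zmk, decZ. destruct (Nat.leb_spec n p).
  - rewrite Nat.even_even, Nat.div2_double. lia.
  - replace (2 * (n - p) - 1)%nat with (2 * (n - p - 1) + 1)%nat by lia.
    rewrite Nat.even_odd.
    replace (S (2 * (n - p - 1) + 1)) with (2 * (n - p))%nat by lia.
    rewrite Nat.div2_double. lia.
Qed.

Lemma qv_eq k : qv k = (INR (qp k) - INR (qn k)) / INR (qd k).
Proof.
  unfold qv, decQ, qp, qn, qd. destruct (cunpair k) as [x y]. cbn [fst snd].
  unfold Q2R. cbn [Qnum Qden]. rewrite decZ_diff, minus_IZR, <- !INR_IZR_INZ.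
  unfold Rdiv. f_equal. f_equal. rewrite INR_IZR_INZ. f_equal; lia.
Qed.

Lemma qd_pos k : 0 < INR (qd k).
Proof. apply lt_0_INR. unfold qd. lia. Qed.

Lemma qv_qmk p n d : (0 < d)%nat -> qv (qmk p n d) = (INR p - INR n) / INR d.
Proof.
  intros Hd. unfold qv, decQ, qmk. rewrite cunpair_cpair.
  unfold Q2R. cbn [Qnum Qden]. rewrite decZ_zmk, minus_IZR, <- !INR_IZR_INZ.
  unfold Rdiv. f_equal. f_equal. rewrite INR_IZR_INZ. f_equal; lia.
Qed.

Ltac qv_arith :=
  intros; rewrite qv_qmk by (unfold qd; lia); rewrite ?qv_eq;
  rewrite ?plus_INR, ?mult_INR, ?plus_INR, ?mult_INR;
  repeat match goal with |- context [INR (qd ?a)] =>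
    lazymatch goal with
    | H : 0 < INR (qd a) |- _ => fail
    | _ => pose proof (qd_pos a)
    end end.

Lemma qv_qfrac p d : (0 < d)%nat -> qv (qfrac p d) = INR p / INR d.
Proof. intros. unfold qfrac. rewrite qv_qmk by auto. simpl (INR 0). f_equal. lra. Qed.

Lemma qv_qadd a b : qv (qadd a b) = qv a + qv b.
Proof. unfold qadd. qv_arith. field. lra. Qed.

Lemma qv_qsub a b : qv (qsub a b) = qv a - qv b.
Proof. unfold qsub. qv_arith. field. lra. Qed.

Lemma qv_qmul a b : qv (qmul a b) = qv a * qv b.
Proof. unfold qmul. qv_arith. field. lra. Qed.

Lemma qp_qn k : qp k = 0%nat \/ qn k = 0%nat.
Proof. unfold qp, qn, zpos, zneg. destruct (_ <=? 0)%nat; auto. Qed.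

Lemma qv_qabs a : qv (qabs a) = Rabs (qv a).
Proof.
  unfold qabs. qv_arith. simpl (INR 0). unfold Rdiv. rewrite Rabs_mult.
  rewrite (Rabs_right (/ _)) by (apply Rle_ge, Rlt_le, Rinv_0_lt_compat; auto).
  f_equal. pose proof (pos_INR (qp a)). pose proof (pos_INR (qn a)).
  destruct (qp_qn a) as [E|E]; rewrite E in *; simpl (INR 0).
  - rewrite Rabs_left1; lra.
  - rewrite Rabs_right; lra.
Qed.

Lemma qltb_spec a b : qltb a b = true <-> qv a < qv b.
Proof.
  unfold qltb. rewrite Nat.ltb_lt, !qv_eq. pose proof (qd_pos a). pose proof (qd_pos b).
  assert (E : forall x y, x / INR (qd a) < y / INR (qd b) <-> x * INR (qd b) < y * INR (qd a)).
  { intros x y. split; intros L.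
    - apply (Rmult_lt_compat_r (INR (qd a) * INR (qd b))) in L; [|nra].
      replace (x / INR (qd a) * (INR (qd a) * INR (qd b))) with (x * INR (qd b)) in L by (field;
      lra).
      replace (y / INR (qd b) * (INR (qd a) * INR (qd b))) with (y * INR (qd a)) in L by (field;
      lra).
      exact L.
    - apply (Rmult_lt_reg_r (INR (qd a) * INR (qd b))); [nra|].
      replace (x / INR (qd a) * (INR (qd a) * INR (qd b))) with (x * INR (qd b)) by (field; lra).
      replace (y / INR (qd b) * (INR (qd a) * INR (qd b))) with (y * INR (qd a)) by (field; lra).
      exact L. }
  rewrite E. split; intros L.
  - apply lt_INR in L. rewrite !plus_INR, !mult_INR in L. lra.
  - apply INR_lt. rewrite !plus_INR, !mult_INR. lra.
Qed.

Lemma qltb_false a b : qltb a b = false <-> qv b <= qv a.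
Proof.
  rewrite <- Bool.not_true_iff_false, qltb_spec. lra.
Qed.

(** The denominator is at least 1. This turns a rational into a natural upper bound, from which the
    sizes of the finite searches over cells are computed. *)
Lemma qv_le_qp a : qv a <= INR (qp a).
Proof.
  rewrite qv_eq. pose proof (qd_pos a). pose proof (pos_INR (qp a)). pose proof (pos_INR (qn a)).
  assert (1 <= INR (qd a)) by (apply (le_INR 1); unfold qd; lia).
  apply (Rmult_le_reg_r (INR (qd a))); [lra|].
  unfold Rdiv. rewrite Rmult_assoc, Rinv_l by lra. nra.
Qed.

Lemma qfloor_spec a m : INR m <= qv a < INR m + 1 -> qfloor a = m.
Proof.
  rewrite qv_eq. intros [L U]. pose proof (qd_pos a).
  assert (L' : INR m * INR (qd a) <= INR (qp a) - INR (qn a)).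
  { apply (Rmult_le_compat_r (INR (qd a))) in L; [|lra].
    unfold Rdiv in L. rewrite Rmult_assoc, Rinv_l in L by lra. lra. }
  assert (U' : INR (qp a) - INR (qn a) < (INR m + 1) * INR (qd a)).
  { apply (Rmult_lt_compat_r (INR (qd a))) in U; [|lra].
    unfold Rdiv in U. rewrite Rmult_assoc, Rinv_l in U by lra. lra. }
  assert (L2 : (m * qd a + qn a <= qp a)%nat).
  { apply INR_le. rewrite plus_INR, mult_INR. lra. }
  assert (U2 : (qp a < S m * qd a + qn a)%nat).
  { apply INR_lt. rewrite plus_INR, mult_INR, S_INR. lra. }
  unfold qfloor. symmetry. apply Nat.div_unique with (qp a - qn a - m * qd a)%nat; lia.
Qed.

Lemma qv_dense x y : x < y -> exists k, x < qv k < y.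
Proof.
  intros Hxy. destruct (archimed_cor1 (y - x)) as [d [Hd Hd0]]; [lra|].
  assert (D : 0 < INR d) by now apply lt_0_INR.
  destruct (archimed (x * INR d)) as [U1 U2]. set (z := up (x * INR d)) in *.
  exists (qmk (Z.to_nat z) (Z.to_nat (- z)) d). rewrite qv_qmk by auto.
  replace (INR (Z.to_nat z) - INR (Z.to_nat (- z))) with (IZR z).
  2:{ rewrite !INR_IZR_INZ, <- minus_IZR. f_equal. lia. }
  assert (I1 : 1 < (y - x) * INR d).
  { apply (Rmult_lt_compat_r (INR d)) in Hd; auto. rewrite Rinv_l in Hd by lra. lra. }
  split; apply (Rmult_lt_reg_r (INR d)); auto;
    unfold Rdiv; rewrite Rmult_assoc, Rinv_l by lra; lra.
Qed.

(** * Finite sums, and comparing Euclidean distances with rationals *)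

Definition qsum (n : nat) (f : nat -> nat) : nat :=
  nat_rect (fun _ => nat) 0%nat (fun i r => qadd r (f i)) n.

Lemma qv_0 : qv 0 = 0.
Proof.
  rewrite qv_eq. change (qp 0) with 0%nat. change (qn 0) with 0%nat.
  simpl (INR 0). unfold Rdiv. ring.
Qed.

Lemma qv_qsum n f : qv (qsum n f) = sumR n (fun i => qv (f i)).
Proof. induction n as [|n IH]; simpl; [apply qv_0|]. now rewrite qv_qadd, IH. Qed.

Lemma recur_qsum n (f : nat -> (nat -> nat) -> nat) :
  recur n -> recur (fun w => f (w 0%nat) (fun i => w (S i))) ->
  recur (fun v => qsum (n v) (fun i => f i v)).
Proof.
  intros Hn Hf. apply (recur_rec _ (fun i r v => qadd r (f i v))); auto with recur.
  apply recur_qadd; [recur|].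
  apply (recur_subst (fun w => f (w 0%nat) (fun i => w (S i)))
    (fun w => scons (w 0%nat) (fun i => w (S (S i))))); auto.
  intros [|i]; recur.
Qed.

(** Squares are compared because the distance of rational points may be irrational; [qltb 0 r]
    rejects the r whose sign squaring would hide. *)
Definition dltb (n : nat) (U V : nat -> nat) (r : nat) : bool :=
  (qltb 0 r &&
   qltb (qsum n (fun i => qmul (qsub (U i) (V i)) (qsub (U i) (V i)))) (qmul r r))%bool.

Lemma recurb_dltb n (U V : nat -> (nat -> nat) -> nat) r :
  recur n -> recur (fun w => U (w 0%nat) (fun i => w (S i))) ->
  recur (fun w => V (w 0%nat) (fun i => w (S i))) -> recur r ->
  recurb (fun v => dltb (n v) (fun i => U i v) (fun i => V i v) (r v)).
Proof.
  intros Hn HU HV Hr. unfold dltb.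
  apply recurb_andb; [auto with recur|]. apply recurb_qltb; [|auto with recur].
  apply (recur_qsum n (fun i v => qmul (qsub (U i v) (V i v)) (qsub (U i v) (V i v))));
  auto with recur.
Qed.

Lemma sumR_ext n f g : (forall i, (i < n)%nat -> f i = g i) -> sumR n f = sumR n g.
Proof. induction n; intros H; simpl; [auto|]. rewrite IHn, H; auto. Qed.

Lemma sumR_sq_nonneg n f : 0 <= sumR n (fun i => f i ^ 2).
Proof. induction n; simpl; [lra|]. pose proof (pow2_ge_0 (f n)). simpl in *. lra. Qed.

Lemma distn_nonneg n u v : 0 <= distn n u v.
Proof. apply sqrt_pos. Qed.

Lemma dltb_spec n U V r :
  dltb n U V r = true <-> distn n (fun i => qv (U i)) (fun i => qv (V i)) < qv r.
Proof.
  unfold dltb, distn. rewrite Bool.andb_true_iff, !qltb_spec, qv_qsum, qv_qmul, qv_0.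
  rewrite (sumR_ext n _ (fun i => (qv (U i) - qv (V i)) ^ 2)).
  2:{ intros i _. rewrite qv_qmul, qv_qsub. ring. }
  pose proof (sumR_sq_nonneg n (fun i => qv (U i) - qv (V i))) as P. cbv beta in P.
  set (s := sumR _ _) in *. pose proof (sqrt_pos s) as Q. pose proof (sqrt_sqrt s P) as E.
  split.
  - intros [H1 H2]. nra.
  - intros H. split; [lra|nra].
Qed.

(** * The Euclidean metric *)

Lemma distn_ext n u u' v v' :
  (forall i, (i < n)%nat -> u i = u' i) -> (forall i, (i < n)%nat -> v i = v' i) ->
  distn n u v = distn n u' v'.
Proof.
  intros Hu Hv. unfold distn. f_equal. apply sumR_ext. intros i Hi. now rewrite Hu, Hv.
Qed.

Lemma distn_sym n u v : distn n u v = distn n v u.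
Proof. unfold distn. f_equal. apply sumR_ext. intros; ring. Qed.

Lemma distn_S n u v : distn (S n) u v = sqrt (distn n u v ^ 2 + (u n - v n) ^ 2).
Proof.
  unfold distn at 1. simpl sumR. f_equal. f_equal. unfold distn.
  rewrite pow2_sqrt; auto. apply sumR_sq_nonneg.
Qed.

(** Minkowski's inequality in the plane; with the distance in the first n coordinates as one leg it
    carries the induction for [distn_triangle]. It rests on [(a^2 + b^2) (c^2 + d^2) - (a c + b d)^2
    = (a d - b c)^2]. *)
Lemma sqrt_sum_sq_triangle a b c d : 0 <= a -> 0 <= c ->
  sqrt ((a + c) ^ 2 + (b + d) ^ 2) <= sqrt (a ^ 2 + b ^ 2) + sqrt (c ^ 2 + d ^ 2).
Proof.
  intros Ha Hc.
  pose proof (sqrt_pos (a ^ 2 + b ^ 2)) as P1. pose proof (sqrt_pos (c ^ 2 + d ^ 2)) as P2.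
  assert (E1 : sqrt (a ^ 2 + b ^ 2) ^ 2 = a ^ 2 + b ^ 2) by (apply pow2_sqrt; nra).
  assert (E2 : sqrt (c ^ 2 + d ^ 2) ^ 2 = c ^ 2 + d ^ 2) by (apply pow2_sqrt; nra).
  set (x := sqrt (a ^ 2 + b ^ 2)) in *. set (y := sqrt (c ^ 2 + d ^ 2)) in *.
  rewrite <- (sqrt_pow2 (x + y)) by lra. apply sqrt_le_1_alt.
  assert (CS : a * c + b * d <= x * y).
  { apply Rnot_lt_le. intros L.
    assert (P : 0 <= x * y) by (apply Rmult_le_pos; auto).
    assert (H : (x * y) ^ 2 < (a * c + b * d) ^ 2) by (simpl; nra).
    replace ((x * y) ^ 2) with (x ^ 2 * y ^ 2) in H by ring. rewrite E1, E2 in H.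
    pose proof (pow2_ge_0 (a * d - b * c)). lra. }
  replace ((x + y) ^ 2) with (x ^ 2 + y ^ 2 + 2 * (x * y)) by ring. rewrite E1, E2. lra.
Qed.

Lemma distn_triangle n u v w : distn n u w <= distn n u v + distn n v w.
Proof.
  induction n as [|n IH].
  - unfold distn. simpl. rewrite sqrt_0. lra.
  - rewrite !distn_S.
    pose proof (distn_nonneg n u v). pose proof (distn_nonneg n v w).
    pose proof (distn_nonneg n u w).
    eapply Rle_trans; [|apply sqrt_sum_sq_triangle; auto].
    apply sqrt_le_1_alt. replace (u n - v n + (v n - w n)) with (u n - w n) by ring. nra.
Qed.

Lemma coord_le_distn n u v i : (i < n)%nat -> Rabs (u i - v i) <= distn n u v.
Proof.
  induction n as [|n IH]; intros Hi; [lia|]. rewrite distn_S.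
  pose proof (distn_nonneg n u v). destruct (Nat.eq_dec i n) as [->|].
  - rewrite <- (sqrt_pow2 (Rabs _)) by apply Rabs_pos.
    apply sqrt_le_1_alt. rewrite pow2_abs. nra.
  - eapply Rle_trans; [apply IH; lia|].
    rewrite <- (sqrt_pow2 (distn n u v)) at 1 by auto. apply sqrt_le_1_alt.
    pose proof (pow2_ge_0 (u n - v n)). lra.
Qed.

(** The factor n in place of the sharp [sqrt n] keeps the slack in the later tests rational. *)
Lemma distn_le_coord n u v e : (forall i, (i < n)%nat -> Rabs (u i - v i) <= e) ->
  distn n u v <= INR n * e.
Proof.
  induction n as [|n IH]; intros H.
  - unfold distn. simpl. rewrite sqrt_0. lra.
  - rewrite distn_S, S_INR. assert (L := IH (fun i Hi => H i (Nat.lt_lt_succ_r _ _ Hi))).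
    assert (K := H n (Nat.lt_succ_diag_r n)).
    pose proof (distn_nonneg n u v). pose proof (Rabs_pos (u n - v n)).
    replace ((INR n + 1) * e) with (INR n * e + e) by ring.
    rewrite <- (sqrt_pow2 (INR n * e + e)) by lra. apply sqrt_le_1_alt.
    rewrite <- (pow2_abs (u n - v n)). nra.
Qed.

(** Bolzano-Weierstrass, one coordinate at a time. In place of strict monotonicity, [k <= phi k] is
    maintained: it is preserved by composition with [psi] and sends indices to infinity. *)
Lemma bounded_convergent_subsequence n (u : nat -> nat -> R) M :
  (forall s i, (i < n)%nat -> Rabs (u s i) <= M) ->
  exists (phi : nat -> nat) (l : nat -> R), (forall k, (k <= phi k)%nat) /\
    forall e, 0 < e -> exists N, forall k, (N <= k)%nat ->
      forall i, (i < n)%nat -> Rabs (u (phi k) i - l i) < e.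
Proof.
  induction n as [|n IH]; intros H.
  - exists (fun k => k), (fun _ => 0). split; auto. intros e _. exists 0%nat. intros. lia.
  - destruct IH as [phi [l [Hphi Hl]]]; [auto|].
    destruct (Bolzano_Weierstrass (fun k => u (phi k) n) (fun c => - M <= c <= M)) as [c Hc].
    + apply compact_P3.
    + intros k. specialize (H (phi k) n ltac:(lia)). revert H.
      unfold Rabs. destruct (Rcase_abs _); lra.
    + assert (P : forall k, exists m, (k <= m)%nat /\ Rabs (u (phi m) n - c) < / INR (S k)).
      { intros k. assert (D : 0 < / INR (S k)) by (apply Rinv_0_lt_compat, lt_0_INR; lia).
        destruct (Hc (disc c (mkposreal _ D)) k) as [m Hm].
        - exists (mkposreal _ D). intros x; auto.
        - exists m. exact Hm. }
      set (psi := fun k => proj1_sig (constructive_indefinite_description _ (P k))).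
      assert (Hpsi : forall k, (k <= psi k)%nat /\ Rabs (u (phi (psi k)) n - c) < / INR (S k))
        by (intros k; exact (proj2_sig (constructive_indefinite_description _ (P k)))).
      exists (fun k => phi (psi k)), (fun i => if Nat.eq_dec i n then c else l i). split.
      * intros k. specialize (Hphi (psi k)). destruct (Hpsi k). lia.
      * intros e He. destruct (Hl e He) as [N HN].
        destruct (archimed_cor1 e He) as [N' [HN' HN0]].
        exists (N + N')%nat. intros k Hk i Hi. destruct (Hpsi k) as [K1 K2].
        destruct (Nat.eq_dec i n) as [->|].
        -- eapply Rlt_trans; [apply K2|]. eapply Rle_lt_trans; [|apply HN'].
           apply Rinv_le_contravar; [apply lt_0_INR; lia|apply le_INR; lia].
        -- apply HN; lia.
Qed.

(** * Rational points and Cauchy names *)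

Lemma code_of_coords n (f : nat -> nat) :
  forall i, (i < n)%nat -> ent (code_list (map f (seq 0 n))) i = f i.
Proof. intros i Hi. rewrite ent_code_list. now apply (nth_prefix f). Qed.

Lemma distn_decQv n k v : distn n (decQv k) v = distn n (fun i => qv (ent k i)) v.
Proof. apply distn_ext; auto. intros. apply decQv_ent. Qed.

Lemma decQv_dense n u e : 0 < e -> exists k, distn n (decQv k) u < e.
Proof.
  intros He. set (d := e / INR (S n)).
  assert (Hn : 0 < INR (S n)) by (apply lt_0_INR; lia).
  assert (Hd : 0 < d) by now apply Rdiv_lt_0_compat.
  assert (P : forall i, exists k, Rabs (qv k - u i) <= d).
  { intros i. destruct (qv_dense (u i) (u i + d)) as [k Hk]; [lra|]. exists k.
    rewrite Rabs_right; lra. }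
  set (f := fun i => proj1_sig (constructive_indefinite_description _ (P i))).
  exists (code_list (map f (seq 0 n))).
  apply Rle_lt_trans with (INR n * d).
  - apply distn_le_coord. intros i Hi. rewrite decQv_ent, code_of_coords by auto.
    exact (proj2_sig (constructive_indefinite_description _ (P i))).
  - replace e with (INR (S n) * d) by (unfold d; field; lra). rewrite S_INR. lra.
Qed.

Lemma half_pow_pos i : 0 < (/ 2) ^ i.
Proof. apply pow_lt. lra. Qed.

Lemma half_pow_small e : 0 < e -> exists N, forall i, (N <= i)%nat -> (/ 2) ^ i < e.
Proof.
  intros He. destruct (pow_lt_1_zero (/ 2)) with e as [N HN]; auto.
  - rewrite Rabs_right; lra.
  - exists N. intros i Hi. specialize (HN i Hi).
    rewrite Rabs_right in HN; auto. apply Rle_ge, Rlt_le, half_pow_pos.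
Qed.

Lemma half_pow_le i j : (i <= j)%nat -> (/ 2) ^ j <= (/ 2) ^ i.
Proof.
  intros H. replace j with (i + (j - i))%nat by lia. rewrite pow_add.
  assert ((/ 2) ^ (j - i) <= 1).
  { rewrite <- (pow1 (j - i)). apply pow_incr. lra. }
  pose proof (half_pow_pos i). nra.
Qed.

Lemma names_Rn_dist n p x i : names_Rn n p x -> distn n (decQv (p i)) (proj1_sig x) <= (/ 2) ^ i.
Proof.
  intros [H1 H2]. apply Rle_plus_epsilon. intros e He.
  destruct (H2 e He) as [N HN].
  specialize (H1 i (i + N)%nat ltac:(lia)). specialize (HN (i + N)%nat ltac:(lia)).
  pose proof (distn_triangle n (decQv (p i)) (decQv (p (i + N)%nat)) (proj1_sig x)). lra.
Qed.

Lemma names_R_dist p x i : names_R p x -> Rabs (qv (p i) - x) <= (/ 2) ^ i.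
Proof.
  intros [H1 H2]. apply Rle_plus_epsilon. intros e He.
  destruct (H2 e He) as [N HN].
  specialize (H1 i (i + N)%nat ltac:(lia)). specialize (HN (i + N)%nat ltac:(lia)).
  unfold qv. pose proof (Rabs_triang (Q2R (decQ (p i)) - Q2R (decQ (p (i + N)%nat)))
    (Q2R (decQ (p (i + N)%nat)) - x)) as T.
  replace (Q2R (decQ (p i)) - Q2R (decQ (p (i + N)%nat)) + (Q2R (decQ (p (i + N)%nat)) - x))
    with (Q2R (decQ (p i)) - x) in T by ring. lra.
Qed.

Lemma names_Rn_intro n p (x : Rn n) :
  (forall i, distn n (decQv (p i)) (proj1_sig x) <= (/ 2) ^ S i) -> names_Rn n p x.
Proof.
  intros H. split.
  - intros i j Hij. pose proof (distn_triangle n (decQv (p i)) (proj1_sig x) (decQv (p j))) as T.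
    rewrite (distn_sym n (proj1_sig x)) in T. pose proof (H i) as Hi. pose proof (H j) as Hj.
    pose proof (half_pow_le i j Hij). simpl in *. lra.
  - intros e He. destruct (half_pow_small e He) as [N HN]. exists N. intros i Hi.
    eapply Rle_lt_trans; [apply H|]. apply HN. lia.
Qed.

Lemma vector_of_coords n (f : nat -> R) :
  exists x : Rn n, forall i, (i < n)%nat -> proj1_sig x i = f i.
Proof.
  unshelve eexists (exist _ (fun i => if lt_dec i n then f i else 0) _).
  - intros i Hi. simpl. destruct (lt_dec i n); [lia|auto].
  - intros i Hi. simpl. destruct (lt_dec i n); [auto|lia].
Qed.

Definition bc (b : nat) : nat := fst (cunpair b).
Definition br (b : nat) : nat := qabs (snd (cunpair b)).

Lemma recur_bc b : recur b -> recur (fun v => bc (b v)).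
Proof. intros Hb. unfold bc. auto with recur. Qed.

Lemma recur_br b : recur b -> recur (fun v => br (b v)).
Proof. intros Hb. unfold br. auto with recur. Qed.
#[export] Hint Resolve recur_bc recur_br : recur.

Lemma qv_br b : qv (br b) = ball_radius b.
Proof.
  unfold br, ball_radius. rewrite qv_qabs. unfold qv. generalize (decQ (snd (cunpair b))).
  intros q. apply Qabs_case; intros H; apply Qle_Rle in H; rewrite ?Q2R_opp;
    replace (Q2R 0) with 0 in H by (unfold Q2R; simpl; lra).
  - apply Rabs_right. lra.
  - apply Rabs_left1. lra.
Qed.

Lemma ball_with_data c r : 0 <= qv r -> bc (cpair c r) = c /\ qv (br (cpair c r)) = qv r.
Proof.
  intros H. unfold bc, br. rewrite cunpair_cpair. cbn [fst snd].
  split; auto. rewrite qv_qabs. apply Rabs_right. lra.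
Qed.

(** * Reducing closed choice to projection *)

Lemma ball_radius_0 : ball_radius 0 = 0.
Proof.
  rewrite <- qv_br. unfold br. rewrite qv_qabs. change (snd (cunpair 0)) with 0%nat.
  rewrite qv_0. apply Rabs_R0.
Qed.

Lemma qv_bc b : qv (bc b) = ball_center_R b.
Proof. reflexivity. Qed.

Lemma ball_center_n_ent b i : ball_center_n b i = qv (ent (bc b) i).
Proof. apply decQv_ent. Qed.

(* Entry [2 <j, b> + 1] is the ball [b] if its first coordinates stay within the interval [p j],
   and an empty ball otherwise; the even entries name the origin. *)
Definition cylinder_prog (m c : nat) : nat :=
  if (m mod 2 <=? 0)%nat then 0%nat
  else if negb (qltb (br (ent c (fst (cunpair (m / 2)))))
      (qadd (qabs (qsub (ent (bc (snd (cunpair (m / 2)))) 0) (bc (ent c (fst (cunpair (m / 2)))))))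
        (br (snd (cunpair (m / 2))))))
    then snd (cunpair (m / 2)) else 0%nat.

Lemma recur_cylinder_prog : recur (fun v => cylinder_prog (v 0%nat) (v 1%nat)).
Proof. unfold cylinder_prog. auto 60 with recur. Qed.

Definition cylinder_functional (p : Baire) (m : nat) : nat :=
  cylinder_prog m (code_list (prefix p (S (fst (cunpair (m / 2)))))).

Lemma cylinder_functional_even p i : cylinder_functional p (2 * i) = 0%nat.
Proof.
  unfold cylinder_functional, cylinder_prog.
  replace (2 * i mod 2)%nat with 0%nat; [reflexivity|].
  symmetry. rewrite Nat.mul_comm. apply Nat.Div0.mod_mul.
Qed.

Lemma cylinder_functional_odd p j b :
  cylinder_functional p (2 * cpair j b + 1) =
  if negb (qltb (br (p j)) (qadd (qabs (qsub (ent (bc b) 0) (bc (p j)))) (br b)))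
  then b else 0%nat.
Proof.
  unfold cylinder_functional, cylinder_prog.
  replace ((2 * cpair j b + 1) / 2)%nat with (cpair j b)
    by (apply Nat.div_unique with 1%nat; lia).
  replace ((2 * cpair j b + 1) mod 2)%nat with 1%nat
    by (apply Nat.mod_unique with (cpair j b); lia).
  rewrite cunpair_cpair. cbn [fst snd].
  rewrite ent_code_list, nth_prefix by lia. reflexivity.
Qed.

Lemma cylinder_functional_odd_cases p i :
  let b := cylinder_functional p (2 * i + 1) in
  b = 0%nat \/ exists j,
    Rabs (ball_center_n b 0%nat - ball_center_R (p j)) + ball_radius b <= ball_radius (p j).
Proof.
  unfold cylinder_functional, cylinder_prog.
  replace ((2 * i + 1) / 2)%nat with i by (apply Nat.div_unique with 1%nat; lia).
  replace ((2 * i + 1) mod 2)%nat with 1%nat by (apply Nat.mod_unique with i; lia).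
  cbn [Nat.leb].
  rewrite ent_code_list, nth_prefix by lia.
  destruct (qltb _ _) eqn:E; cbn [negb]; [now left|right].
  exists (fst (cunpair i)). apply qltb_false in E.
  rewrite qv_qadd, qv_qabs, qv_qsub, !qv_br in E.
  rewrite ball_center_n_ent, <- qv_bc. exact E.
Qed.

Lemma cylinder_functional_names n p A : (1 <= n)%nat -> names_AR p A ->
  names_An n (fun i => cylinder_functional p (2 * i + 1)) (fun y => A (proj1_sig y 0%nat)).
Proof.
  intros Hn HA y. rewrite (HA _). apply not_iff_compat. split.
  - intros [j Hj]. set (y0 := proj1_sig y 0%nat) in *.
    (* Half the gap: the distance from y to the new centre costs less than r in the first
       coordinate, and the radius of the new ball costs r again. *)
    destruct (qv_dense 0 ((ball_radius (p j) - Rabs (ball_center_R (p j) - y0)) / 2))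
      as [r [Hr0 Hr]]; [lra|].
    destruct (decQv_dense n (proj1_sig y) (qv r) Hr0) as [c Hc].
    destruct (ball_with_data c r) as [Ec Er]; [lra|].
    exists (cpair j (cpair c r)). rewrite cylinder_functional_odd.
    replace (qltb _ _) with false; cbn [negb].
    + unfold ball_center_n. change (fst (cunpair (cpair c r))) with (bc (cpair c r)).
      rewrite <- qv_br, Ec, Er. exact Hc.
    + symmetry. apply qltb_false. rewrite qv_qadd, qv_qabs, qv_qsub, Ec, Er, qv_br, qv_bc.
      pose proof (coord_le_distn n (decQv c) (proj1_sig y) 0 Hn) as K.
      rewrite decQv_ent in K. fold (qv (ent c 0)) in K. fold y0 in K.
      pose proof (Rabs_triang (qv (ent c 0) - y0) (y0 - ball_center_R (p j))) as T.
      rewrite (Rabs_minus_sym y0) in T.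
      replace (qv (ent c 0) - y0 + (y0 - ball_center_R (p j)))
        with (qv (ent c 0) - ball_center_R (p j)) in T by ring. lra.
  - intros [i Hi]. destruct (cylinder_functional_odd_cases p i) as [E|[j Hj]].
    + rewrite E, ball_radius_0 in Hi. pose proof (distn_nonneg n (ball_center_n 0) (proj1_sig y)).
      lra.
    + exists j. set (b := cylinder_functional p (2 * i + 1)) in *.
      pose proof (coord_le_distn n (ball_center_n b) (proj1_sig y) 0 Hn) as K.
      pose proof (Rabs_triang (ball_center_R (p j) - ball_center_n b 0%nat)
        (ball_center_n b 0%nat - proj1_sig y 0%nat)) as T.
      rewrite (Rabs_minus_sym (ball_center_R (p j)) (ball_center_n b 0%nat)) in T.
      replace (ball_center_R (p j) - ball_center_n b 0%nat +
          (ball_center_n b 0%nat - proj1_sig y 0%nat))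
        with (ball_center_R (p j) - proj1_sig y 0%nat) in T by ring. lra.
Qed.

Theorem C_R_le_eps_Proj eps n : (1 <= n)%nat ->
  sW_le names_AR names_R C_R
    (names_prod (names_Rn n) (names_An n)) (names_Rn n) (eps_Proj eps n).
Proof.
  intros Hn.
  exists (fun q => Some (fun m => ent (ent (code_list (prefix q (S m))) m) 0)).
  exists (fun p => Some (cylinder_functional p)).
  split; [|split].
  - apply (computable_functional (fun m c => ent (ent c m) 0) (fun m => m)); auto with recur.
  - apply (computable_functional cylinder_prog (fun m => fst (cunpair (m / 2)))).
    + apply recur_cylinder_prog.
    + auto with recur.
  - intros G HG p A HA [a Ha].
    destruct (vector_of_coords n (fun i => a)) as [z Hz].
    destruct (vector_of_coords n (fun i => 0)) as [o Ho].
    destruct (HG (cylinder_functional p) (o, fun y : Rn n => A (proj1_sig y 0%nat)))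
      as [q [Eq [y [Hq [Hy _]]]]].
    + split.
      * apply names_Rn_intro. intros i. cbn [fst]. rewrite cylinder_functional_even.
        rewrite (distn_ext n _ (proj1_sig o) _ (proj1_sig o)); auto.
        -- pose proof (distn_le_coord n (proj1_sig o) (proj1_sig o) 0) as L.
           rewrite Rmult_0_r in L. eapply Rle_trans; [apply L|apply Rlt_le, half_pow_pos].
           intros j _. rewrite Rminus_diag, Rabs_R0. lra.
        (* Code 0 is the empty list; its missing coordinates read as code 0, which is the rational
           0. *)
        -- intros j Hj. rewrite Ho by auto. unfold decQv. change (decode_list 0) with (@nil nat).
           destruct j; exact qv_0.
      * now apply cylinder_functional_names.
    + exists z. cbn [snd]. now rewrite Hz by lia.
    + unfold pcomp. rewrite Eq. eexists. split; [reflexivity|].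
      exists (proj1_sig y 0%nat). split; [|exact Hy].
      assert (E : forall i, Q2R (decQ (ent (ent (code_list (prefix q (S i))) i) 0))
        = decQv (q i) 0%nat).
      { intros i. rewrite decQv_ent, (ent_code_list (prefix q (S i))), nth_prefix; auto. }
      destruct Hq as [H1 H2]. split.
      * intros i j Hij. rewrite !E. eapply Rle_trans; [|apply (H1 i j Hij)].
        now apply (coord_le_distn n (decQv (q i)) (decQv (q j))).
      * intros e He. destruct (H2 e He) as [N HN]. exists N. intros i Hi. rewrite E.
        eapply Rle_lt_trans; [|apply (HN i Hi)].
        now apply (coord_le_distn n (decQv (q i)) (proj1_sig y)).
Qed.

(** * The programs reducing projection to closed choice *)

#[export] Hint Resolve recurb_ballb recurb_dltb : recur.

(** The n low bits of a digit carry one bit of each coordinate. The two further bits are [01] in the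
    digits produced for a given point, which places them between [beta/4] and [beta/2]. *)
Definition beta (n : nat) : nat := 2 ^ (n + 2).

(* Bits of coordinate [i] of the point coded by the base-[beta n] expansion whose first [t] digits
   after the point give [N]: digit [j] from the right carries bit [j]. *)
Definition bits (n t N i : nat) : nat :=
  nat_rect (fun _ => nat) 0%nat (fun j r => r + (N / beta n ^ j / 2 ^ i) mod 2 * 2 ^ j)%nat t.

(** Coordinate i of the lower corner of the level-t dyadic cube coded by N. The integer part
    [N / beta n ^ t] is the guess, whose entries 0 and 1 are taken; hence the shift by 2. *)
Definition corner (n t N i : nat) : nat :=
  qadd (ent (N / beta n ^ t) (2 + i)) (qfrac (bits n t N i) (2 ^ t)).

(** [n / 2^s] bounds the diameter of a cell of side [2^-s]. Success puts the whole cell with lower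
    corner U into the ball, and cells containing a fixed point of the open ball succeed once s is
    large. *)
Definition inside (n s : nat) (U : nat -> nat) (b : nat) : bool :=
  dltb n U (fun i => ent (bc b) i) (qsub (br b) (qfrac n (2 ^ s))).

(** Cells per half axis. The half-width [qp a + 2] exceeds [a + 1], where 1 allows for the error
    [2^-s] of the approximate centre. *)
Definition grid_half (s a : nat) : nat := ((qp a + 2) * 2 ^ s)%nat.

(** The digits of z in base [2 * grid_half s a] are the positions of the cell along the axes, so one
    bounded quantifier over z ranges over the whole grid. *)
Definition grid (o : nat -> nat) (s a z i : nat) : nat :=
  qadd (ent (o (2 * s)%nat) i)
    (qmk ((z / (2 * grid_half s a) ^ i) mod (2 * grid_half s a)) (grid_half s a) (2 ^ s)).

(* Every cell of side [2^-s] meeting the ball of radius [a] around [x] lies in one of the first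
   [s] balls; the grid is centred at the approximation [o (2 * s)] of [x]. *)
Definition cert (n : nat) (o : nat -> nat) (s a : nat) : bool :=
  (negb (qltb 0 a) ||
   ballb ((2 * grid_half s a) ^ n) (fun z =>
     negb (dltb n (fun i => grid o s a z i) (fun i => ent (o (2 * s)%nat) i)
       (qadd a (qfrac (S n) (2 ^ s)))) ||
     negb (ballb s (fun j =>
       negb (inside n s (fun i => grid o s a z i) (o (2 * j + 1)%nat))))))%bool.

(* A guess is the code of the list [s; a; corner of the cube].  The oracle [o] is the joint name of
   [x] (even entries) and [A] (odd entries). *)
Definition stage (n t N : nat) : nat := ent (N / beta n ^ t) 0.
Definition radius (n t N : nat) : nat := qabs (ent (N / beta n ^ t) 1).

(** The certificate is demanded only from level [stage] on; this confines level t to the first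
    [2 t + 1] oracle entries, and every guess is still tested eventually. The slack [n + 2] is made
    of n for the cell, 1 for the name of x and 1 for strictness. *)
Definition check (n ec : nat) (o : nat -> nat) (t N : nat) : bool :=
  ((negb (stage n t N <=? t)%nat || cert n o (stage n t N) (radius n t N)) &&
   (dltb n (fun i => corner n t N i) (fun i => ent (o (2 * t)%nat) i)
      (qadd (qmul ec (radius n t N)) (qfrac (n + 2) (2 ^ t))) &&
    ballb t (fun j => negb (inside n t (fun i => corner n t N i) (o (2 * j + 1)%nat)))))%bool.

(** Scaled by [beta n ^ t], the cell has midpoint [N + 1/2] and half-length [1/4]; the test compares
    the distance of the midpoints with the sum of the radii. *)
Definition meets (n b t N : nat) : bool :=
  qltb (qabs (qsub (bc b) (qfrac (2 * N + 1) (2 * beta n ^ t))))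
    (qadd (br b) (qfrac 1 (4 * beta n ^ t))).

(* Entry [<t, b>] is the ball [b] if it misses all level-[t] cells passing [check], and an empty
   ball otherwise; the bound covers all cells that [b] can meet. *)
Definition choice_prog (n ec : nat) (o : nat -> nat) (m : nat) : nat :=
  if ballb (beta n ^ fst (cunpair m) * (qp (bc (snd (cunpair m))) + qp (br (snd (cunpair m)))) + 1)
      (fun N => negb (check n ec o (fst (cunpair m)) N) ||
                negb (meets n (snd (cunpair m)) (fst (cunpair m)) N))%bool
  then snd (cunpair m) else 0%nat.

Definition tabulate (n : nat) (f : nat -> nat) : nat :=
  nat_rect (fun _ => nat) 0%nat (fun j r => S (cpair (f (n - S j)%nat) r)) n.

(** At level [m + 1 + n] the diameter bound [n 2^-(m+1+n)] is at most [2^-(m+1)], as [n <= 2^n].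
    Since [beta n ^ t = 2^((n+2) t)], the entry at [decode_at] has scaled error at most [1/8], below
    the margin [1/4], so its floor is exact. *)
Definition level (n m : nat) : nat := (m + 1 + n)%nat.
Definition decode_at (n m : nat) : nat := ((n + 2) * level n m + 3)%nat.
Definition decode_prog (n m c : nat) : nat :=
  tabulate n (fun i => corner n (level n m)
    (qfloor (qmul (qfrac (beta n ^ level n m) 1) (ent c (decode_at n m)))) i).

Lemma recur_bits n t N i : recur n -> recur t -> recur N -> recur i ->
  recur (fun v => bits (n v) (t v) (N v) (i v)).
Proof.
  intros Hn Ht HN Hi. unfold bits, beta.
  assert (L : forall f, recur f -> recur (fun w => f (fun i => w (S (S i))))).
  { intros f Hf. apply (recur_subst f (fun w i => w (S (S i)))); auto with recur. }
  apply L in Hn, HN, Hi.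
  apply (recur_rec _ (fun j r v => r + (N v / (2 ^ (n v + 2)) ^ j / 2 ^ i v) mod 2 * 2 ^ j)%nat);
    auto 20 with recur.
Qed.
#[export] Hint Resolve recur_bits : recur.

Lemma recur_choice_prog n ec :
  recur (fun v => choice_prog n ec (ent (v 1%nat)) (v 0%nat)).
Proof.
  unfold choice_prog, check, meets, cert, inside, corner, stage, radius, grid, grid_half, beta.
  auto 200 with recur.
Qed.

Lemma recur_tabulate n (f : nat -> (nat -> nat) -> nat) :
  recur (fun w => f (w 0%nat) (fun i => w (S i))) ->
  recur (fun v => tabulate n (fun i => f i v)).
Proof.
  intros Hf. apply (recur_rec _ (fun j r v => S (cpair (f (n - S j)%nat v) r))); auto with recur.
  apply recur_S, recur_cpair; [|recur].
  apply (recur_subst (fun w => f (w 0%nat) (fun i => w (S i)))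
    (fun w => scons (n - S (w 0))%nat (fun i => w (S (S i))))); auto.
  intros [|i]; recur.
Qed.

Lemma recur_decode_prog n : recur (fun v => decode_prog n (v 0%nat) (v 1%nat)).
Proof.
  unfold decode_prog, corner, decode_at, level, beta.
  apply (recur_tabulate n (fun i v => _)). auto 200 with recur.
Qed.

(** * Certificates for lower bounds on the distance *)

Lemma ballb_ext b P Q : (forall i, (i < b)%nat -> P i = Q i) -> ballb b P = ballb b Q.
Proof. induction b; intros H; simpl; auto. rewrite H, IHb; auto. Qed.

Lemma cert_ext n o o' s a : (forall j, (j < 2 * s + 1)%nat -> o j = o' j) ->
  cert n o s a = cert n o' s a.
Proof.
  intros H. unfold cert, grid. f_equal. rewrite (H (2 * s)%nat) by lia.
  apply ballb_ext. intros z _. f_equal. f_equal. apply ballb_ext. intros j Hj.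
  now rewrite H by lia.
Qed.

Lemma check_ext n ec o o' t N : (forall j, (j < 2 * t + 1)%nat -> o j = o' j) ->
  check n ec o t N = check n ec o' t N.
Proof.
  intros H. unfold check. rewrite (H (2 * t)%nat) by lia. f_equal; [|f_equal].
  - destruct (Nat.leb_spec (stage n t N) t); cbn [negb orb]; auto.
    apply cert_ext. intros j Hj. apply H. lia.
  - apply ballb_ext. intros j Hj. now rewrite H by lia.
Qed.

Lemma tabulate_eq n f : tabulate n f = code_list (map f (seq 0 n)).
Proof.
  unfold tabulate. assert (G : forall j, (j <= n)%nat ->
    nat_rect (fun _ => nat) 0%nat (fun j r => S (cpair (f (n - S j)%nat) r)) j
    = code_list (map f (seq (n - j) j))).
  { induction j as [|j IH]; intros Hj; [reflexivity|].
    cbn [nat_rect seq map code_list]. rewrite IH by lia.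
    replace (S (n - S j)) with (n - j)%nat by lia. reflexivity. }
  rewrite G, Nat.sub_diag; auto.
Qed.

(** * Dyadic cells and grids *)

Lemma INR_pow2 t : INR (2 ^ t) = 2 ^ t.
Proof. now rewrite pow_INR. Qed.

Lemma pow2_pos t : (0 < 2 ^ t)%nat.
Proof. pose proof (Nat.pow_nonzero 2 t). lia. Qed.

Lemma half_pow t : (/ 2) ^ t = / 2 ^ t.
Proof. apply pow_inv. Qed.

Lemma pow2_half t : 2 ^ t * (/ 2) ^ t = 1.
Proof. rewrite <- Rpow_mult_distr. replace (2 * / 2) with 1 by lra. apply pow1. Qed.

Lemma qv_dyadic p t : qv (qfrac p (2 ^ t)) = INR p * (/ 2) ^ t.
Proof. rewrite qv_qfrac, INR_pow2, half_pow; [reflexivity|apply pow2_pos]. Qed.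

Lemma nat_floor x : 0 <= x -> exists m, INR m <= x < INR m + 1.
Proof.
  intros Hx. destruct (archimed x) as [H1 H2].
  exists (Z.to_nat (up x - 1)).
  assert (0 < up x)%Z by (apply lt_IZR; lra).
  rewrite INR_IZR_INZ, Z2Nat.id, minus_IZR by lia. lra.
Qed.

Lemma digits_exist b n h : (forall i, (i < n)%nat -> (h i < b)%nat) ->
  exists z, (z < b ^ n)%nat /\ forall i, (i < n)%nat -> ((z / b ^ i) mod b = h i)%nat.
Proof.
  induction n as [|n IH]; intros H.
  - exists 0%nat. split; [simpl; lia|]. intros; lia.
  - destruct IH as [z [Hz Hd]]; auto. specialize (H n ltac:(lia)).
    assert (P : (0 < b ^ n)%nat) by lia.
    exists (z + h n * b ^ n)%nat. split; [simpl; nia|]. intros i Hi.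
    destruct (Nat.eq_dec i n) as [->|].
    + rewrite Nat.div_add by lia. rewrite (Nat.div_small z) by auto. now apply Nat.mod_small.
    + rewrite <- (Hd i) by lia.
      replace (h n * b ^ n)%nat with (h n * b ^ (n - S i) * b * b ^ i)%nat.
      2:{ replace (b ^ n)%nat with (b ^ (n - S i + 1 + i))%nat by (f_equal; lia).
          rewrite !Nat.pow_add_r, Nat.pow_1_r. ring. }
      rewrite Nat.div_add by (apply Nat.pow_nonzero; lia).
      now rewrite Nat.Div0.mod_add.
Qed.

Definition in_cell (n s : nat) (u y : nat -> R) : Prop :=
  forall i, (i < n)%nat -> u i <= y i <= u i + (/ 2) ^ s.

Lemma in_cell_dist n s u y : in_cell n s u y -> distn n u y <= INR n * (/ 2) ^ s.
Proof.
  intros H. apply distn_le_coord. intros i Hi. destruct (H i Hi).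
  rewrite Rabs_left1; lra.
Qed.

Lemma inside_spec n s U b :
  inside n s U b = true <->
  distn n (fun i => qv (U i)) (ball_center_n b) < ball_radius b - INR n * (/ 2) ^ s.
Proof.
  unfold inside. rewrite dltb_spec, qv_qsub, qv_br, qv_dyadic.
  rewrite (distn_ext n _ (fun i => qv (U i)) _ (ball_center_n b)); [tauto|auto|].
  intros i _. now rewrite ball_center_n_ent.
Qed.

Lemma inside_cell n s U b y : inside n s U b = true -> in_cell n s (fun i => qv (U i)) y ->
  distn n (ball_center_n b) y < ball_radius b.
Proof.
  rewrite inside_spec. intros H C. apply in_cell_dist in C.
  pose proof (distn_triangle n (ball_center_n b) (fun i => qv (U i)) y) as T.
  rewrite (distn_sym n (ball_center_n b) (fun i => qv (U i))) in T. lra.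
Qed.

Lemma dltb_name n U k r :
  dltb n U (fun i => ent k i) r = true <-> distn n (fun i => qv (U i)) (decQv k) < qv r.
Proof.
  rewrite dltb_spec, (distn_sym n _ (decQv k)), distn_decQv, distn_sym. reflexivity.
Qed.

Lemma in_cell_grid n o s a y :
  (forall i, (i < n)%nat -> Rabs (y i - decQv (o (2 * s)%nat) i) < INR (qp a) + 2) ->
  exists z, (z < (2 * grid_half s a) ^ n)%nat /\ in_cell n s (fun i => qv (grid o s a z i)) y.
Proof.
  intros H. set (W := grid_half s a).
  assert (EW : INR W = (INR (qp a) + 2) * 2 ^ s).
  { unfold W, grid_half. rewrite mult_INR, plus_INR, INR_pow2. simpl. ring. }
  assert (Ps : 0 < 2 ^ s) by (apply pow_lt; lra).
  assert (P : forall i, exists h, (i < n)%nat ->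
    (h < 2 * W)%nat /\ INR h <= (y i - decQv (o (2 * s)%nat) i) * 2 ^ s + INR W < INR h + 1).
  { intros i. destruct (lt_dec i n) as [Hi|]; [|exists 0%nat; lia].
    specialize (H i Hi). apply Rabs_def2 in H. destruct H as [U L].
    destruct (nat_floor ((y i - decQv (o (2 * s)%nat) i) * 2 ^ s + INR W)) as [h Hh]; [nra|].
    exists h. intros _. split; auto. apply INR_lt. rewrite mult_INR. simpl (INR 2). nra. }
  set (h := fun i => proj1_sig (constructive_indefinite_description _ (P i))).
  assert (Hh : forall i, (i < n)%nat -> (h i < 2 * W)%nat /\
    INR (h i) <= (y i - decQv (o (2 * s)%nat) i) * 2 ^ s + INR W < INR (h i) + 1)
    by (intros i; exact (proj2_sig (constructive_indefinite_description _ (P i)))).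
  destruct (digits_exist (2 * W) n h) as [z [Hz Hd]]; [intros i Hi; now apply Hh|].
  exists z. split; auto. intros i Hi. unfold grid. fold W. rewrite Hd by auto.
  rewrite qv_qadd, qv_qmk by apply pow2_pos. rewrite INR_pow2.
  destruct (Hh i Hi) as [_ B]. rewrite half_pow.
  replace (qv (ent (o (2 * s)%nat) i)) with (decQv (o (2 * s)%nat) i) by apply decQv_ent.
  set (d := decQv (o (2 * s)%nat) i) in *. unfold Rdiv.
  assert (I : 2 ^ s * / 2 ^ s = 1) by (apply Rinv_r; lra).
  assert (0 < / 2 ^ s) by now apply Rinv_0_lt_compat.
  set (w := / 2 ^ s) in *.
  assert (E : y i = d + ((y i - d) * 2 ^ s + INR W) * w - INR W * w).
  { replace (d + ((y i - d) * 2 ^ s + INR W) * w - INR W * w)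
      with (d + (y i - d) * (2 ^ s * w)) by ring. rewrite I. ring. }
  set (del := (y i - d) * 2 ^ s + INR W) in *. nra.
Qed.

Section Certificates.
Variables (n : nat) (p : Baire) (x : Rn n) (A : Rn n -> Prop).
Hypothesis Hx : names_Rn n (fun i => p (2 * i)%nat) x.
Hypothesis HA : names_An n (fun i => p (2 * i + 1)%nat) A.

Lemma outside_balls y j : A y ->
  ball_radius (p (2 * j + 1)%nat) <= distn n (ball_center_n (p (2 * j + 1)%nat)) (proj1_sig y).
Proof.
  intros Ay. apply Rnot_lt_le. intros L. apply (proj1 (HA y) Ay). now exists j.
Qed.

Lemma name_near s : distn n (decQv (p (2 * s)%nat)) (proj1_sig x) <= (/ 2) ^ s.
Proof. exact (names_Rn_dist n _ x s Hx). Qed.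

(** A point of A closer than a would lie in a grid cell, and the certificate places that cell in a
    ball avoiding A. *)
Lemma cert_sound s a y : cert n p s a = true -> 0 < qv a -> A y ->
  qv a <= distn n (proj1_sig x) (proj1_sig y).
Proof.
  intros HC Ha Ay. apply Rnot_lt_le. intros L.
  unfold cert in HC. rewrite Bool.orb_true_iff in HC. destruct HC as [HC|HC].
  { apply Bool.negb_true_iff, qltb_false in HC. rewrite qv_0 in HC. lra. }
  rewrite ballb_spec in HC.
  pose proof (name_near s) as Nx. pose proof (half_pow_le 0 s ltac:(lia)) as P1. simpl in P1.
  pose proof (distn_triangle n (proj1_sig y) (proj1_sig x) (decQv (p (2 * s)%nat))) as T.
  rewrite (distn_sym n (proj1_sig y) (proj1_sig x)), (distn_sym n (proj1_sig x) (decQv _)) in T.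
  pose proof (qv_le_qp a) as Q.
  destruct (in_cell_grid n p s a (proj1_sig y)) as [z [Hz C]].
  { intros i Hi. eapply Rle_lt_trans; [apply (coord_le_distn n); auto|]. lra. }
  specialize (HC z Hz). rewrite Bool.orb_true_iff, !Bool.negb_true_iff in HC.
  destruct HC as [HC|HC].
  (* The cell cannot be dismissed as too far away: its corner is within [n 2^-s] of y and the centre
     within [2^-s] of x, which is the slack [S n] of the test. *)
  - apply Bool.not_true_iff_false in HC. apply HC. rewrite dltb_name.
    rewrite qv_qadd, qv_dyadic, S_INR. apply in_cell_dist in C.
    pose proof (distn_triangle n (fun i => qv (grid p s a z i)) (proj1_sig y) (decQv (p (2 *
      s)%nat))).
    lra.
  - apply Bool.not_true_iff_false in HC. apply HC. rewrite ballb_spec. intros j Hj.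
    apply Bool.negb_true_iff, Bool.not_true_iff_false. intros I.
    apply (inside_cell _ _ _ _ (proj1_sig y)) in I; auto.
    pose proof (outside_balls y j Ay). lra.
Qed.

Lemma half_pow_scaled_small c e : 0 <= c -> 0 < e ->
  exists N, forall i, (N <= i)%nat -> c * (/ 2) ^ i < e.
Proof.
  intros Hc He. destruct (half_pow_small (e / (c + 1))) as [N HN].
  { apply Rdiv_lt_0_compat; lra. }
  exists N. intros i Hi. specialize (HN i Hi). pose proof (half_pow_pos i).
  apply (Rmult_lt_compat_r (c + 1)) in HN; [|lra].
  unfold Rdiv in HN. rewrite Rmult_assoc, Rinv_l in HN by lra. nra.
Qed.

(* If no stage certified the bound, the uncovered cells would accumulate at a point of [A]
   in the closed ball. *)
Lemma cert_complete a : 0 < qv a ->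
  (forall y, A y -> qv a < distn n (proj1_sig x) (proj1_sig y)) ->
  exists s, cert n p s a = true.
Proof.
  intros Ha Hfar. apply NNPP. intros Hno.
  assert (P : forall s, exists z,
    distn n (fun i => qv (grid p s a z i)) (decQv (p (2 * s)%nat)) < qv a + INR (S n) * (/ 2) ^ s /\
    forall j, (j < s)%nat -> inside n s (fun i => grid p s a z i) (p (2 * j + 1)%nat) = false).
  { intros s. apply NNPP. intros Hz. apply Hno. exists s. unfold cert.
    apply Bool.orb_true_iff. right. apply ballb_spec. intros z _.
    apply Bool.orb_true_iff. rewrite !Bool.negb_true_iff.
    apply NNPP. intros Hor. apply Hz. exists z. apply not_or_and in Hor. destruct Hor as [H1 H2].
    apply Bool.not_false_iff_true in H1, H2. split.
    - rewrite dltb_name, qv_qadd, qv_dyadic in H1. exact H1.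
    - intros j Hj. rewrite ballb_spec in H2. specialize (H2 j Hj).
      now apply Bool.negb_true_iff in H2. }
  set (z := fun s => proj1_sig (constructive_indefinite_description _ (P s))).
  set (g := fun s i => qv (grid p s a (z s) i)).
  assert (Hg : forall s, distn n (g s) (decQv (p (2 * s)%nat)) < qv a + INR (S n) * (/ 2) ^ s /\
    forall j, (j < s)%nat -> inside n s (fun i => grid p s a (z s) i) (p (2 * j + 1)%nat) = false)
    by (intros s; exact (proj2_sig (constructive_indefinite_description _ (P s)))).
  assert (Hgx : forall s, distn n (g s) (proj1_sig x) < qv a + INR (n + 2) * (/ 2) ^ s).
  { intros s. destruct (Hg s) as [H1 _]. pose proof (name_near s).
    pose proof (distn_triangle n (g s) (decQv (p (2 * s)%nat)) (proj1_sig x)).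
    rewrite S_INR in H1. rewrite plus_INR. simpl (INR 2). lra. }
  destruct (bounded_convergent_subsequence n (fun s i => g s i - proj1_sig x i) (qv a + INR (n +
    2)))
    as [phi [l [Hphi Hl]]].
  { intros s i Hi. eapply Rle_trans; [apply (coord_le_distn n (g s) (proj1_sig x)); auto|].
    specialize (Hgx s). pose proof (half_pow_le 0 s ltac:(lia)) as P1. simpl in P1.
    pose proof (pos_INR (n + 2)). nra. }
  destruct (vector_of_coords n (fun i => proj1_sig x i + l i)) as [y Hy].
  assert (Hlim : forall e, 0 < e -> exists N, forall k, (N <= k)%nat ->
    distn n (g (phi k)) (proj1_sig y) < e).
  { intros e He. destruct (Hl (e / INR (S n))) as [N HN].
    { apply Rdiv_lt_0_compat; auto. apply lt_0_INR. lia. }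
    exists N. intros k Hk. apply Rle_lt_trans with (INR n * (e / INR (S n))).
    - apply distn_le_coord. intros i Hi. rewrite Hy by auto.
      replace (g (phi k) i - (proj1_sig x i + l i)) with (g (phi k) i - proj1_sig x i - l i)
        by ring.
      apply Rlt_le. now apply HN.
    - assert (D : 0 < INR (S n)) by (apply lt_0_INR; lia).
      apply Rlt_le_trans with (INR (S n) * (e / INR (S n))); [|right; field; lra].
      apply Rmult_lt_compat_r; [now apply Rdiv_lt_0_compat|]. rewrite S_INR. lra. }
  (* An enumerated ball containing the limit would contain the late cells too, with room for their
     shrinking diameter, but [inside] has rejected them. *)
  assert (Ay : A y).
  { apply HA. intros [j Hj]. set (b := p (2 * j + 1)%nat) in *.
    set (e := ball_radius b - distn n (ball_center_n b) (proj1_sig y)).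
    destruct (Hlim (e / 2)) as [N HN]; [unfold e; lra|].
    destruct (half_pow_scaled_small (INR n) (e / 2)) as [N' HN'];
      [apply pos_INR|unfold e; lra|].
    set (k := (S j + N + N')%nat). assert (K := Hphi k).
    assert (Ek : (S j + N + N' <= k)%nat) by (unfold k; lia).
    specialize (HN k ltac:(lia)). specialize (HN' (phi k) ltac:(lia)).
    destruct (Hg (phi k)) as [_ H2]. specialize (H2 j ltac:(lia)).
    apply Bool.not_true_iff_false in H2. apply H2. apply inside_spec.
    change (fun i => qv (grid p (phi k) a (z (phi k)) i)) with (g (phi k)). fold b.
    pose proof (distn_triangle n (g (phi k)) (proj1_sig y) (ball_center_n b)) as T.
    rewrite (distn_sym n (proj1_sig y)) in T. unfold e in *. lra. }
  specialize (Hfar y Ay). set (e := distn n (proj1_sig x) (proj1_sig y) - qv a).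
  destruct (Hlim (e / 2)) as [N HN]; [unfold e; lra|].
  destruct (half_pow_scaled_small (INR (n + 2)) (e / 2)) as [N' HN'];
    [apply pos_INR|unfold e; lra|].
  set (k := (N + N')%nat). assert (K := Hphi k).
  assert (Ek : (N + N' <= k)%nat) by (unfold k; lia).
  specialize (HN k ltac:(lia)). specialize (HN' (phi k) ltac:(lia)). specialize (Hgx (phi k)).
  pose proof (distn_triangle n (proj1_sig x) (g (phi k)) (proj1_sig y)) as T.
  rewrite (distn_sym n (proj1_sig x) (g _)) in T. unfold e in *. lra.
Qed.
End Certificates.

(** * The closed set of surviving guesses *)

Definition cell_interval (n t N : nat) (r : R) : Prop :=
  INR N + / 4 <= INR (beta n ^ t) * r <= INR N + 3 / 4.

(** Cells are chosen independently at each level, their nesting being derived in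
    [cell_interval_parent]. Each level contributes a locally finite union of closed intervals, so
    the intersection is closed. *)
Definition choice_set (n ec : nat) (p : Baire) (r : R) : Prop :=
  forall t, exists N, check n ec p t N = true /\ cell_interval n t N r.

Definition choice_functional (n ec : nat) (p : Baire) (m : nat) : nat :=
  choice_prog n ec (ent (code_list (prefix p (S (2 * fst (cunpair m)))))) m.

Lemma choice_functional_eq n ec p m : choice_functional n ec p m = choice_prog n ec p m.
Proof.
  unfold choice_functional, choice_prog. erewrite ballb_ext; [reflexivity|].
  intros N _. cbv beta. f_equal. f_equal. apply check_ext. intros j Hj.
  rewrite ent_code_list. apply nth_prefix. lia.
Qed.

Lemma beta_ge_4 n : (4 <= beta n)%nat.
Proof.
  unfold beta. rewrite Nat.pow_add_r. pose proof (pow2_pos n). change (2 ^ 2)%nat with 4%nat. lia.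
Qed.

Lemma beta_pow_pos n t : (0 < beta n ^ t)%nat.
Proof. pose proof (beta_ge_4 n). pose proof (Nat.pow_nonzero (beta n) t). lia. Qed.

Lemma INR_beta_pow_pos n t : 0 < INR (beta n ^ t).
Proof. apply lt_0_INR, beta_pow_pos. Qed.

Lemma meets_spec n b t N : meets n b t N = true <->
  Rabs (INR (beta n ^ t) * ball_center_R b - (INR N + / 2)) <
  INR (beta n ^ t) * ball_radius b + / 4.
Proof.
  pose proof (beta_pow_pos n t) as P. pose proof (INR_beta_pow_pos n t) as Q.
  unfold meets. rewrite qltb_spec, qv_qabs, qv_qsub, qv_qadd, !qv_qfrac, qv_br, qv_bc by lia.
  rewrite plus_INR, !mult_INR. simpl (INR 1). replace (INR 2) with 2 by (simpl; ring).
  replace (INR 4) with 4 by (simpl; ring). set (M := INR (beta n ^ t)) in *.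
  replace (M * ball_center_R b - (INR N + / 2))
    with (M * (ball_center_R b - (2 * INR N + 1) / (2 * M))) by (field; lra).
  replace (M * ball_radius b + / 4) with (M * (ball_radius b + 1 / (4 * M))) by (field; lra).
  rewrite Rabs_mult, (Rabs_right M) by lra. split; intros H; nra.
Qed.

(** The bound on N justifies the search bound in [choice_prog]: a cell meeting the ball begins below
    its right end, and negative cells do not exist. *)
Lemma meets_of_common_point n b t N r :
  cell_interval n t N r -> Rabs (ball_center_R b - r) < ball_radius b ->
  meets n b t N = true /\ (N < beta n ^ t * (qp (bc b) + qp (br b)) + 1)%nat.
Proof.
  intros [C1 C2] H. pose proof (INR_beta_pow_pos n t) as Q.
  assert (Mt : meets n b t N = true).
  { apply meets_spec. set (M := INR (beta n ^ t)) in *.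
    apply Rabs_def2 in H. destruct H. apply Rabs_def1; nra. }
  split; auto. apply meets_spec in Mt. apply Rabs_def2 in Mt. destruct Mt as [_ Mt].
  apply INR_lt. rewrite plus_INR, mult_INR, plus_INR. simpl (INR 1).
  pose proof (qv_le_qp (bc b)) as L1. pose proof (qv_le_qp (br b)) as L2.
  rewrite qv_br in L2. rewrite qv_bc in L1. nra.
Qed.

Lemma INR_apart N N' : N <> N' -> 1 <= Rabs (INR N - INR N').
Proof.
  intros H. destruct (Nat.lt_gt_cases N N') as [K _]. destruct (K H) as [L|L];
    apply le_INR in L; rewrite S_INR in L.
  - rewrite Rabs_left1; lra.
  - rewrite Rabs_right; lra.
Qed.

(** Distinct midpoints are at least 1 apart, so at most one lies at distance less than [1/2] from z.
    That one determines the gap; for the others [1/4] serves. *)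
Lemma cells_locally_finite (P : nat -> Prop) z :
  (forall N, P N -> ~ (INR N + / 4 <= z <= INR N + 3 / 4)) ->
  exists d, 0 < d /\ forall N, P N -> / 4 + d <= Rabs (z - (INR N + / 2)).
Proof.
  intros H. destruct (classic (exists N, P N /\ Rabs (z - (INR N + / 2)) < / 2)) as [[N0 [P0
    L0]]|Hno].
  - exists (Rmin (/ 4) (Rabs (z - (INR N0 + / 2)) - / 4)).
    assert (L : / 4 < Rabs (z - (INR N0 + / 2))).
    { apply Rnot_le_lt. intros L. apply (H N0 P0). revert L.
      unfold Rabs. destruct (Rcase_abs _); lra. }
    split; [apply Rmin_pos; lra|]. intros N PN.
    destruct (Nat.eq_dec N N0) as [->|Hne].
    + pose proof (Rmin_r (/ 4) (Rabs (z - (INR N0 + / 2)) - / 4)). lra.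
    + pose proof (Rmin_l (/ 4) (Rabs (z - (INR N0 + / 2)) - / 4)).
      pose proof (INR_apart N N0 Hne) as K.
      pose proof (Rabs_triang (z - (INR N0 + / 2)) (- (z - (INR N + / 2)))) as T.
      rewrite Rabs_Ropp in T.
      replace (z - (INR N0 + / 2) + - (z - (INR N + / 2))) with (INR N - INR N0) in T by ring. lra.
  - exists (/ 4). split; [lra|]. intros N PN. apply Rnot_lt_le. intros L.
    apply Hno. exists N. split; auto. lra.
Qed.

Lemma choice_functional_names n ec p : names_AR (choice_functional n ec p) (choice_set n ec p).
Proof.
  intros r. split.
  - intros HB [m Hm]. rewrite choice_functional_eq in Hm. unfold choice_prog in Hm.
    set (t := fst (cunpair m)) in *. set (b := snd (cunpair m)) in *.
    destruct (ballb _ _) eqn:E in Hm.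
    + rewrite ballb_spec in E. destruct (HB t) as [N [CN IN]].
      destruct (meets_of_common_point n b t N r IN Hm) as [M1 M2].
      specialize (E N M2). rewrite CN, M1 in E. discriminate.
    + rewrite ball_radius_0 in Hm. pose proof (Rabs_pos (ball_center_R 0 - r)). lra.
  - intros Hno t. apply NNPP. intros Hbad. apply Hno.
    destruct (cells_locally_finite (fun N => check n ec p t N = true) (INR (beta n ^ t) * r))
      as [d [Hd Hsep]].
    { intros N CN IN. apply Hbad. now exists N. }
    pose proof (INR_beta_pow_pos n t) as Q. set (M := INR (beta n ^ t)) in *.
    (* Scaled by M, the distance from r to the centre and the radius together use up less than
       [2 M rho < d], so the ball stays clear of all passing cells. *)
    destruct (qv_dense 0 (d / (2 * M))) as [rho [R1 R2]]; [apply Rdiv_lt_0_compat; lra|].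
    destruct (qv_dense (r - qv rho) r) as [c [C1 C2]]; [lra|].
    destruct (ball_with_data c rho) as [Ec Er]; [lra|].
    assert (R3 : M * qv rho < d / 2).
    { apply (Rmult_lt_compat_l M) in R2; auto.
      replace (M * (d / (2 * M))) with (d / 2) in R2 by (field; lra). exact R2. }
    assert (Bc : ball_center_R (cpair c rho) = qv c) by (rewrite <- qv_bc; now rewrite Ec).
    assert (Br : ball_radius (cpair c rho) = qv rho) by now rewrite <- qv_br.
    exists (cpair t (cpair c rho)). rewrite choice_functional_eq. unfold choice_prog.
    rewrite cunpair_cpair. cbn [fst snd].
    replace (ballb _ _) with true.
    + rewrite Bc, Br. apply Rabs_def1; lra.
    + symmetry. apply ballb_spec. intros N _. apply Bool.orb_true_iff.
      destruct (check n ec p t N) eqn:CN; [right|now left].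
      apply Bool.negb_true_iff, Bool.not_true_iff_false. rewrite meets_spec, Bc, Br. fold M.
      specialize (Hsep N CN).
      pose proof (Rabs_triang (M * qv c - (INR N + / 2)) (M * r - M * qv c)) as T.
      replace (M * qv c - (INR N + / 2) + (M * r - M * qv c)) with (M * r - (INR N + / 2)) in T
        by ring.
      rewrite (Rabs_right (M * r - M * qv c)) in T by nra. nra.
Qed.

(** The supremum of the left ends lies in every interval. It serves both for the coordinates of the
    decoded point and for the real that codes a guess. *)
Lemma nested_limit (f w : nat -> R) : (forall t, f t <= f (S t)) ->
  (forall t, f (S t) + w (S t) <= f t + w t) -> (forall t, 0 <= w t) ->
  exists y, forall t, f t <= y <= f t + w t.
Proof.
  intros Hf Hw Hp.
  assert (Mono : forall s k, f s <= f (s + k)%nat /\ f (s + k)%nat + w (s + k)%nat <= f s + w s).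
  { intros s. induction k as [|k [I1 I2]]; [rewrite Nat.add_0_r; lra|].
    rewrite Nat.add_succ_r. specialize (Hf (s + k)%nat). specialize (Hw (s + k)%nat). lra. }
  assert (Bd : forall s t, f s <= f t + w t).
  { intros s t. destruct (Nat.le_ge_cases s t) as [L|L].
    - destruct (Mono s (t - s)%nat) as [I _]. replace (s + (t - s))%nat with t in I by lia.
      specialize (Hp t). lra.
    - destruct (Mono t (s - t)%nat) as [_ I]. replace (t + (s - t))%nat with s in I by lia.
      specialize (Hp s). lra. }
  destruct (completeness (fun z => exists t, z = f t)) as [y [U L]].
  - exists (f 0%nat + w 0%nat). intros z [t ->]. apply Bd.
  - exists (f 0%nat). now exists 0%nat.
  - exists y. intros t. split; [apply U; now exists t|]. apply L. intros z [s ->]. apply Bd.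
Qed.

(** The definition peels off the leading digit, whereas passing to a finer cell appends a digit at
    the other end; this is the recursion in that order. *)
Lemma bits_S n t N i :
  bits n (S t) N i = (2 * bits n t (N / beta n) i + (N / 2 ^ i) mod 2)%nat.
Proof.
  assert (Step : forall t N, bits n (S t) N i
    = (bits n t N i + (N / beta n ^ t / 2 ^ i) mod 2 * 2 ^ t)%nat) by reflexivity.
  revert N. induction t as [|t IH]; intros N.
  - rewrite Step. change (bits n 0 N i) with 0%nat. change (bits n 0 (N / beta n) i) with 0%nat.
    rewrite !Nat.pow_0_r, Nat.div_1_r. lia.
  - rewrite Step, IH, (Step t (N / beta n)%nat).
    rewrite (Nat.Div0.div_div N (beta n)), !Nat.pow_succ_r'. lia.
Qed.

(** As [beta n >= 4], a margin of [1/4] grows to at least one unit at the next level, which keeps N'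
    within the block of children of N. *)
Lemma cell_interval_parent n t N N' r :
  cell_interval n t N r -> cell_interval n (S t) N' r -> (N' / beta n = N)%nat.
Proof.
  unfold cell_interval. rewrite Nat.pow_succ_r', mult_INR. intros [L1 U1] [L2 U2].
  pose proof (le_INR _ _ (beta_ge_4 n)) as B4. replace (INR 4) with 4 in B4 by (simpl; ring).
  rewrite Rmult_assoc in L2, U2. set (z := INR (beta n ^ t) * r) in *.
  assert (G1 : (beta n * N < N' + 1)%nat).
  { apply INR_lt. rewrite plus_INR, mult_INR. simpl (INR 1). nra. }
  assert (G2 : (N' < beta n * N + beta n)%nat).
  { apply INR_lt. rewrite plus_INR, mult_INR. nra. }
  symmetry. apply Nat.div_unique with (N' - beta n * N)%nat; lia.
Qed.

Lemma qv_corner n t N i :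
  qv (corner n t N i) = qv (ent (N / beta n ^ t) (2 + i)) + INR (bits n t N i) * (/ 2) ^ t.
Proof. unfold corner. now rewrite qv_qadd, qv_dyadic. Qed.

Lemma dist_set_exists n (x : Rn n) A : (exists a, A a) -> exists m, dist_set_is x A m.
Proof.
  intros [a Ha].
  destruct (completeness (fun z => exists b, A b /\ z = - distn n (proj1_sig x) (proj1_sig b)))
    as [m [U L]].
  - exists 0. intros z [b [_ ->]]. pose proof (distn_nonneg n (proj1_sig x) (proj1_sig b)). lra.
  - eexists. exists a. split; eauto.
  - exists (- m). split.
    + intros s [b [Hb ->]]. specialize (U _ (ex_intro _ b (conj Hb eq_refl))). lra.
    + intros m' Hm'. enough (m <= - m') by lra. apply L. intros z [b [Hb ->]].
      assert (m' <= distn n (proj1_sig x) (proj1_sig b)) by (apply Hm'; eauto). lra.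
Qed.

Lemma check_spec n ec p t N : check n ec p t N = true <->
  ((stage n t N <= t)%nat -> cert n p (stage n t N) (radius n t N) = true) /\
  distn n (fun i => qv (corner n t N i)) (decQv (p (2 * t)%nat)) <
    qv ec * qv (radius n t N) + INR (n + 2) * (/ 2) ^ t /\
  forall j, (j < t)%nat -> inside n t (fun i => corner n t N i) (p (2 * j + 1)%nat) = false.
Proof.
  unfold check. rewrite !Bool.andb_true_iff, dltb_name, qv_qadd, qv_qmul, qv_dyadic, ballb_spec.
  assert (E1
    : (negb (stage n t N <=? t)%nat || cert n p (stage n t N) (radius n t N))%bool = true <->
    ((stage n t N <= t)%nat -> cert n p (stage n t N) (radius n t N) = true)).
  { destruct (Nat.leb_spec (stage n t N) t) as [L|L]; cbn [negb orb]; [tauto|].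
    split; auto. lia. }
  assert (E2 : forall i b, negb (inside n t i b) = true <-> inside n t i b = false)
    by (intros; apply Bool.negb_true_iff).
  rewrite E1. split; intros [H1 [H2 H3]]; (split; [exact H1|split; [exact H2|]]);
    intros j Hj; apply E2; auto.
Qed.

Lemma pow2_ge_id m : INR m <= 2 ^ m.
Proof.
  rewrite <- INR_pow2. apply le_INR. pose proof (Nat.pow_gt_lin_r 2 m). lia.
Qed.

Lemma decode_correct n r q (N : nat -> nat) m : names_R q r ->
  (forall t, cell_interval n t (N t) r) ->
  forall i, (i < n)%nat ->
  ent (decode_prog n m (code_list (prefix q (S (decode_at n m))))) i
  = corner n (level n m) (N (level n m)) i.
Proof.
  intros Hq HN i Hi. unfold decode_prog. rewrite tabulate_eq, code_of_coords by auto.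
  rewrite ent_code_list, nth_prefix by lia. f_equal. apply qfloor_spec.
  rewrite qv_qmul, qv_qfrac by lia. simpl (INR 1). unfold Rdiv. rewrite Rinv_1, Rmult_1_r.
  destruct (HN (level n m)) as [L U].
  pose proof (names_R_dist q r (decode_at n m) Hq) as D.
  assert (E : INR (beta n ^ level n m) * (/ 2) ^ decode_at n m = / 8).
  { unfold beta, decode_at. rewrite <- Nat.pow_mul_r, INR_pow2, pow_add.
    rewrite <- Rmult_assoc, pow2_half. simpl. lra. }
  pose proof (INR_beta_pow_pos n (level n m)) as P.
  set (M := INR (beta n ^ level n m)) in *. set (e := (/ 2) ^ decode_at n m) in *.
  assert (K : Rabs (M * (qv (q (decode_at n m)) - r)) <= / 8).
  { rewrite Rabs_mult, (Rabs_right M) by lra. nra. }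
  assert (K2 : - / 8 <= M * (qv (q (decode_at n m)) - r) <= / 8).
  { revert K. unfold Rabs. destruct (Rcase_abs _); lra. }
  lra.
Qed.

(** * Soundness and completeness of the set of surviving guesses *)

Section Reduction.
Variables (eps : R) (n ec : nat) (p : Baire) (x : Rn n) (A : Rn n -> Prop).
Hypothesis Hx : names_Rn n (fun i => p (2 * i)%nat) x.
Hypothesis HA : names_An n (fun i => p (2 * i + 1)%nat) A.
Hypothesis Hec : 1 < qv ec < 1 + eps.

Lemma choice_set_sound r q : (exists a, A a) -> choice_set n ec p r -> names_R q r ->
  exists y, names_Rn n (fun m => decode_prog n m (code_list (prefix q (S (decode_at n m))))) y /\
    A y /\ exists m, dist_set_is x A m /\ distn n (proj1_sig x) (proj1_sig y) <= (1 + eps) * m.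
Proof.
  intros HAne HB Hq.
  set (N := fun t => proj1_sig (constructive_indefinite_description _ (HB t))).
  assert (HN : forall t, check n ec p t (N t) = true /\ cell_interval n t (N t) r)
    by (intros t; exact (proj2_sig (constructive_indefinite_description _ (HB t)))).
  assert (Par : forall t, (N (S t) / beta n = N t)%nat).
  { intros t. apply (cell_interval_parent n t _ _ r); apply HN. }
  (* The integer part is the same at all levels, so a single guess governs all the tests. *)
  assert (Key : forall t, (N t / beta n ^ t = N 0)%nat).
  { induction t as [|t IH]; [apply Nat.div_1_r|].
    now rewrite Nat.pow_succ_r', <- Nat.Div0.div_div, Par. }
  set (s := ent (N 0%nat) 0). set (a := qabs (ent (N 0%nat) 1)).
  assert (Hs : forall t, stage n t (N t) = s) by (intros t; unfold stage; now rewrite Key).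
  assert (Hr : forall t, radius n t (N t) = a) by (intros t; unfold radius; now rewrite Key).
  set (D := fun t i => qv (corner n t (N t) i)).
  assert (HD : forall t i, exists b, (b < 2)%nat /\ D (S t) i = D t i + INR b * (/ 2) ^ S t).
  { intros t i. exists ((N (S t) / 2 ^ i) mod 2)%nat. split; [apply Nat.mod_upper_bound; lia|].
    unfold D. rewrite !qv_corner, !Key, bits_S, Par, plus_INR, mult_INR. simpl. lra. }
  assert (Lim : forall i, exists y, forall t, D t i <= y <= D t i + (/ 2) ^ t).
  { intros i. apply nested_limit.
    - intros t. destruct (HD t i) as [b [_ ->]]. pose proof (pos_INR b).
      pose proof (half_pow_pos (S t)). nra.
    - intros t. destruct (HD t i) as [b [Hb ->]].
      assert (INR b <= 1) by (apply (le_INR b 1); lia).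
      pose proof (half_pow_pos t). simpl. nra.
    - intros t. apply Rlt_le, half_pow_pos. }
  destruct (vector_of_coords n
    (fun i => proj1_sig (constructive_indefinite_description _ (Lim i)))) as [y Hy].
  assert (Cell : forall t, in_cell n t (D t) (proj1_sig y)).
  { intros t i Hi. rewrite Hy by auto.
    exact (proj2_sig (constructive_indefinite_description _ (Lim i)) t). }
  assert (Chk : forall t, ((s <= t)%nat -> cert n p s a = true) /\
    distn n (D t) (decQv (p (2 * t)%nat)) < qv ec * qv a + INR (n + 2) * (/ 2) ^ t /\
    forall j, (j < t)%nat -> inside n t (fun i => corner n t (N t) i) (p (2 * j + 1)%nat) = false).
  { intros t. destruct (HN t) as [C _]. apply check_spec in C. now rewrite Hs, Hr in C. }
  assert (Ay : A y).
  { apply HA. intros [j Hj]. set (b := p (2 * j + 1)%nat) in *.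
    destruct (half_pow_scaled_small (2 * INR n)
      (ball_radius b - distn n (ball_center_n b) (proj1_sig y))) as [T HT];
      [pose proof (pos_INR n); lra|lra|].
    set (t := (S j + T)%nat). assert (Et : (S j + T <= t)%nat) by (unfold t; lia).
    specialize (HT t ltac:(lia)). destruct (Chk t) as [_ [_ C]]. specialize (C j ltac:(lia)).
    apply Bool.not_true_iff_false in C. apply C. apply inside_spec. fold b.
    change (fun i => qv (corner n t (N t) i)) with (D t).
    pose proof (in_cell_dist _ _ _ _ (Cell t)).
    pose proof (distn_triangle n (D t) (proj1_sig y) (ball_center_n b)) as Tr.
    rewrite (distn_sym n (proj1_sig y)) in Tr. lra. }
  (* The constant [2 n + 3] adds 1 for the name of x, [n + 2] for the slack of the test and n from
     the corner to y. *)
  assert (Up : distn n (proj1_sig x) (proj1_sig y) <= qv ec * qv a).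
  { apply Rle_plus_epsilon. intros e He.
    destruct (half_pow_scaled_small (2 * INR n + 3) e) as [T HT];
      [pose proof (pos_INR n); lra|auto|].
    specialize (HT T (le_n T)). destruct (Chk T) as [_ [C _]].
    rewrite plus_INR in C. replace (INR 2) with 2 in C by (simpl; ring).
    pose proof (in_cell_dist _ _ _ _ (Cell T)).
    pose proof (name_near n p x Hx T).
    pose proof (distn_triangle n (proj1_sig x) (decQv (p (2 * T)%nat)) (proj1_sig y)) as T1.
    pose proof (distn_triangle n (decQv (p (2 * T)%nat)) (D T) (proj1_sig y)) as T2.
    rewrite (distn_sym n (proj1_sig x) (decQv _)) in T1.
    rewrite (distn_sym n (decQv _) (D T)) in T2. lra. }
  assert (Ha : 0 <= qv a) by (unfold a; rewrite qv_qabs; apply Rabs_pos).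
  (* For positive a the certificate is read off at level s, the first one that demands it. *)
  assert (Low : forall z, A z -> qv a <= distn n (proj1_sig x) (proj1_sig z)).
  { intros z Az. destruct (Rle_lt_or_eq_dec _ _ Ha) as [P|E].
    - apply (cert_sound n p x A Hx HA s); auto. now apply (Chk s).
    - rewrite <- E. apply distn_nonneg. }
  exists y. split; [|split; [exact Ay|]].
  - apply names_Rn_intro. intros m. set (t := level n m).
    rewrite (distn_ext n _ (D t) _ (proj1_sig y)); auto.
    + eapply Rle_trans; [apply in_cell_dist, Cell|].
      unfold t, level. replace (m + 1 + n)%nat with (S m + n)%nat by lia. rewrite pow_add.
      pose proof (pow2_ge_id n). pose proof (pow2_half n). pose proof (half_pow_pos n).
      pose proof (half_pow_pos (S m)).
      replace (INR n * ((/ 2) ^ S m * (/ 2) ^ n)) with ((/ 2) ^ S m * (INR n * (/ 2) ^ n)) by ring.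
      rewrite <- (Rmult_1_r ((/ 2) ^ S m)) at 2. apply Rmult_le_compat_l; [lra|]. nra.
    + intros i Hi. rewrite decQv_ent. unfold D. fold (qv (ent (decode_prog n m
        (code_list (prefix q (S (decode_at n m))))) i)).
      rewrite (decode_correct n r q N); auto. intros t'. apply HN.
  - destruct (dist_set_exists n x A HAne) as [m Hm]. exists m. split; auto.
    destruct Hm as [_ Hm]. assert (qv a <= m).
    { apply Hm. intros z [b [Ab ->]]. now apply Low. }
    nra.
Qed.

Lemma choice_set_guess : (exists a, A a) ->
  exists s a y, cert n p s (qabs a) = true /\ A y /\
    distn n (proj1_sig x) (proj1_sig y) <= qv ec * qv (qabs a).
Proof.
  intros HAne. destruct (dist_set_exists n x A HAne) as [m [M1 M2]].
  assert (M0 : 0 <= m).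
  { apply M2. intros z [b [_ ->]]. apply distn_nonneg. }
  assert (Lb : forall y, A y -> m <= distn n (proj1_sig x) (proj1_sig y)) by (intros; apply M1;
  eauto).
  destruct (Rle_lt_or_eq_dec _ _ M0) as [P|E].
  - assert (Q : m / qv ec < m).
    { apply (Rmult_lt_reg_r (qv ec)); [lra|]. unfold Rdiv. rewrite Rmult_assoc, Rinv_l by lra.
      nra. }
    (* [a < m] lets a stage certify a, while [m < c a] yields a point of A within [c a] even before
       the infimum is known to be attained. *)
    destruct (qv_dense (m / qv ec) m Q) as [a [A1 A2]].
    assert (0 < m / qv ec) by (apply Rdiv_lt_0_compat; lra).
    assert (A3 : m < qv ec * qv a).
    { apply (Rmult_lt_compat_l (qv ec)) in A1; [|lra].
      replace (qv ec * (m / qv ec)) with m in A1 by (field; lra). exact A1. }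
    assert (Ea : qv (qabs a) = qv a) by (rewrite qv_qabs; apply Rabs_right; lra).
    destruct (cert_complete n p x A Hx HA (qabs a)) as [s Hs]; [lra| |].
    { intros y Ay. specialize (Lb y Ay). lra. }
    assert (Y : exists y, A y /\ distn n (proj1_sig x) (proj1_sig y) <= qv ec * qv a).
    { apply NNPP. intros Hno. enough (qv ec * qv a <= m) by lra. apply M2.
      intros z [b [Ab ->]]. apply Rnot_lt_le. intros L. apply Hno. exists b. split; auto. lra. }
    destruct Y as [y [Ay Hy]]. exists s, a, y. rewrite Ea in *. auto.
  - assert (E0 : qv (qabs 0) = 0) by (rewrite qv_qabs, qv_0; apply Rabs_R0).
    exists 0%nat, 0%nat, x. rewrite E0. split; [|split].
    + unfold cert. apply Bool.orb_true_iff. left. apply Bool.negb_true_iff, qltb_false.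
      rewrite qv_0. lra.
    (* A ball around x avoiding A would make the infimum positive, so at distance 0 the point x
       itself belongs to A. *)
    + apply HA. intros [j Hj]. set (b := p (2 * j + 1)%nat) in *.
      enough (ball_radius b - distn n (ball_center_n b) (proj1_sig x) <= m) by lra.
      apply M2. intros z [y [Ay ->]]. pose proof (outside_balls n p A HA y j Ay) as O. fold b in O.
      pose proof (distn_triangle n (ball_center_n b) (proj1_sig x) (proj1_sig y)). lra.
    + pose proof (distn_le_coord n (proj1_sig x) (proj1_sig x) 0) as L.
      rewrite !Rmult_0_r in *. apply L. intros i _. rewrite Rminus_diag, Rabs_R0. lra.
Qed.

(* The expansion of [v] in base 2, read off as bits, and packed with [n] bits per digit. *)
Lemma packed_expansion k (v : nat -> R) : (forall i, 0 <= v i < 1) ->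
  exists N : nat -> nat, N 0%nat = k /\
    (forall t, exists d, (d < 2 ^ n)%nat /\ N (S t) = (beta n * N t + 2 ^ n + d)%nat) /\
    forall t i, (i < n)%nat ->
      INR (bits n t (N t) i) * (/ 2) ^ t <= v i <= (INR (bits n t (N t) i) + 1) * (/ 2) ^ t.
Proof.
  intros Hv.
  assert (FP : forall t i, exists m, INR m <= 2 ^ t * v i < INR m + 1).
  { intros t i. apply nat_floor. apply Rmult_le_pos; [apply pow_le; lra|apply Hv]. }
  set (F := fun t i => proj1_sig (constructive_indefinite_description _ (FP t i))).
  assert (HF : forall t i, INR (F t i) <= 2 ^ t * v i < INR (F t i) + 1)
    by (intros t i; exact (proj2_sig (constructive_indefinite_description _ (FP t i)))).
  assert (Bit : forall t i, (2 * F t i <= F (S t) i < 2 * F t i + 2)%nat).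
  { intros t i. pose proof (HF t i) as [L1 U1]. pose proof (HF (S t) i) as [L2 U2]. simpl in L2, U2.
    split.
    - apply Nat.lt_succ_r, INR_lt. rewrite S_INR, mult_INR. simpl (INR 2). lra.
    - apply INR_lt. rewrite plus_INR, mult_INR. simpl (INR 2). lra. }
  assert (DP : forall t, exists d, (d < 2 ^ n)%nat /\
    forall i, (i < n)%nat -> ((d / 2 ^ i) mod 2 = F (S t) i - 2 * F t i)%nat).
  { intros t. apply digits_exist. intros i _. specialize (Bit t i). lia. }
  set (d := fun t => proj1_sig (constructive_indefinite_description _ (DP t))).
  assert (Hd : forall t, (d t < 2 ^ n)%nat /\
    forall i, (i < n)%nat -> ((d t / 2 ^ i) mod 2 = F (S t) i - 2 * F t i)%nat)
    by (intros t; exact (proj2_sig (constructive_indefinite_description _ (DP t)))).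
  set (N := nat_rect (fun _ => nat) k (fun t r => (beta n * r + 2 ^ n + d t)%nat)).
  assert (NS : forall t, N (S t) = (beta n * N t + 2 ^ n + d t)%nat) by reflexivity.
  assert (E : forall t i, (i < n)%nat -> bits n t (N t) i = F t i).
  { induction t as [|t IH]; intros i Hi.
    - change (bits n 0 (N 0%nat) i) with 0%nat. destruct (HF 0%nat i) as [L U].
      specialize (Hv i). simpl in L, U.
      assert (F 0%nat i < 1)%nat by (apply INR_lt; simpl; lra). lia.
    - rewrite bits_S. destruct (Hd t) as [D1 D2].
      replace (N (S t) / beta n)%nat with (N t).
      + rewrite IH by auto. specialize (D2 i Hi). specialize (Bit t i).
        replace ((N (S t) / 2 ^ i) mod 2)%nat with ((d t / 2 ^ i) mod 2)%nat; [lia|].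
        rewrite NS.
        (* For [i < n], both the earlier digits and the marker [2^n] contribute multiples of
           [2^(i+1)], so bit i is that of [d t]. *)
        replace (beta n * N t + 2 ^ n + d t)%nat
          with (d t + (4 * N t + 1) * 2 ^ (n - S i) * 2 * 2 ^ i)%nat.
        * rewrite Nat.div_add by (apply Nat.pow_nonzero; lia). now rewrite Nat.Div0.mod_add.
        * unfold beta. rewrite Nat.pow_add_r.
          replace (2 ^ n)%nat with (2 ^ (n - S i + 1 + i))%nat by (f_equal; lia).
          rewrite !Nat.pow_add_r. simpl. ring.
      + rewrite NS. apply Nat.div_unique with (2 ^ n + d t)%nat; [|ring].
        unfold beta. rewrite Nat.pow_add_r. simpl. lia. }
  exists N. split; [reflexivity|]. split.
  - intros t. exists (d t). split; [apply Hd|apply NS].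
  - intros t i Hi. rewrite E by auto. specialize (HF t i). pose proof (half_pow_pos t).
    pose proof (pow2_half t) as I.
    replace (v i) with (2 ^ t * v i * (/ 2) ^ t).
    + split; apply Rmult_le_compat_r; lra.
    + rewrite Rmult_assoc, (Rmult_comm (v i)), <- Rmult_assoc, I. ring.
Qed.

(** The marker [2^n] equals [beta/4], the left margin of the parent, and [d < 2^n] keeps the digit
    clear of the right margin at [3 beta/4]; so the intervals are nested. *)
Lemma cell_intervals_meet (N : nat -> nat) :
  (forall t, exists d, (d < 2 ^ n)%nat /\ N (S t) = (beta n * N t + 2 ^ n + d)%nat) ->
  exists r, forall t, cell_interval n t (N t) r.
Proof.
  intros HN.
  destruct (nested_limit (fun t => (INR (N t) + / 4) / INR (beta n ^ t))
    (fun t => / 2 / INR (beta n ^ t))) as [r Hr].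
  - intros t. destruct (HN t) as [d [_ ->]].
    rewrite Nat.pow_succ_r', mult_INR, !plus_INR, mult_INR.
    pose proof (INR_beta_pow_pos n t) as P. pose proof (pos_INR d).
    pose proof (lt_0_INR _ (pow2_pos n)) as P2.
    assert (B : INR (beta n) = 4 * INR (2 ^ n)).
    { unfold beta. rewrite Nat.pow_add_r, mult_INR. simpl. ring. }
    rewrite B. apply (Rmult_le_reg_r (4 * INR (2 ^ n) * INR (beta n ^ t))); [nra|].
    field_simplify; nra.
  - intros t. destruct (HN t) as [d [Hd ->]].
    rewrite Nat.pow_succ_r', mult_INR, !plus_INR, mult_INR.
    pose proof (INR_beta_pow_pos n t) as P. pose proof (pos_INR d).
    pose proof (lt_0_INR _ (pow2_pos n)) as P2.
    assert (D : INR d + 1 <= INR (2 ^ n)) by (rewrite <- S_INR; now apply le_INR).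
    assert (B : INR (beta n) = 4 * INR (2 ^ n)).
    { unfold beta. rewrite Nat.pow_add_r, mult_INR. simpl. ring. }
    rewrite B. apply (Rmult_le_reg_r (4 * INR (2 ^ n) * INR (beta n ^ t))); [nra|].
    field_simplify; nra.
  - intros t. pose proof (INR_beta_pow_pos n t). apply Rlt_le, Rdiv_lt_0_compat; lra.
  - exists r. intros t. destruct (Hr t) as [L U]. pose proof (INR_beta_pow_pos n t) as P.
    unfold cell_interval. set (M := INR (beta n ^ t)) in *.
    apply (Rmult_le_compat_l M) in L, U; try lra.
    replace (M * ((INR (N t) + / 4) / M)) with (INR (N t) + / 4) in L by (field; lra).
    replace (M * ((INR (N t) + / 4) / M + / 2 / M)) with (INR (N t) + 3 / 4) in U by (field; lra).
    lra.
Qed.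

Lemma choice_set_complete : (exists a, A a) -> exists r, choice_set n ec p r.
Proof.
  intros HAne. destruct (choice_set_guess HAne) as [s [a [y [Hs [Ay Hy]]]]].
  (* A rational corner strictly below y and less than 1 away leaves offsets in [(0, 1)], which have
     binary expansions without integer part. *)
  assert (BP : forall i, exists k, proj1_sig y i - 1 < qv k < proj1_sig y i)
    by (intros i; apply qv_dense; lra).
  set (b := fun i => proj1_sig (constructive_indefinite_description _ (BP i))).
  assert (Hb : forall i, proj1_sig y i - 1 < qv (b i) < proj1_sig y i)
    by (intros i; exact (proj2_sig (constructive_indefinite_description _ (BP i)))).
  destruct (packed_expansion (code_list (s :: a :: map b (seq 0 n)))
    (fun i => proj1_sig y i - qv (b i))) as [N [N0 [NS NB]]].
  { intros i. specialize (Hb i). lra. }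
  destruct (cell_intervals_meet N NS) as [r Hr]. exists r.
  assert (Key : forall t, (N t / beta n ^ t)%nat = code_list (s :: a :: map b (seq 0 n))).
  { induction t as [|t IH]; [now rewrite Nat.pow_0_r, Nat.div_1_r|].
    rewrite Nat.pow_succ_r', <- Nat.Div0.div_div.
    now rewrite (cell_interval_parent n t (N t) (N (S t)) r). }
  intros t. exists (N t). split; auto.
  assert (Rad : radius n t (N t) = qabs a).
  { unfold radius. now rewrite Key, ent_code_list. }
  assert (Cell : in_cell n t (fun i => qv (corner n t (N t) i)) (proj1_sig y)).
  { intros i Hi. rewrite qv_corner, Key, ent_code_list.
    change (nth (2 + i) (s :: a :: map b (seq 0 n)) 0%nat) with (nth i (prefix b n) 0%nat).
    rewrite nth_prefix by auto. specialize (NB t i Hi). lra. }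
  apply check_spec. rewrite Rad. split; [|split].
  - intros _. unfold stage. now rewrite Key, ent_code_list.
  - apply in_cell_dist in Cell. pose proof (name_near n p x Hx t) as X.
    rewrite plus_INR. replace (INR 2) with 2 by (simpl; ring). pose proof (half_pow_pos t).
    set (D := fun i => qv (corner n t (N t) i)) in *.
    pose proof (distn_triangle n D (proj1_sig y) (decQv (p (2 * t)%nat))) as T1.
    pose proof (distn_triangle n (proj1_sig y) (proj1_sig x) (decQv (p (2 * t)%nat))) as T2.
    rewrite (distn_sym n (proj1_sig y) (proj1_sig x)), (distn_sym n (proj1_sig x) (decQv _)) in T2.
    lra.
  - intros j Hj. apply Bool.not_true_iff_false. intros I.
    apply (inside_cell _ _ _ _ (proj1_sig y)) in I; auto.
    pose proof (outside_balls n p A HA y j Ay). lra.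
Qed.
End Reduction.

Theorem eps_Proj_le_C_R eps n : 0 < eps ->
  sW_le (names_prod (names_Rn n) (names_An n)) (names_Rn n) (eps_Proj eps n)
    names_AR names_R C_R.
Proof.
  intros Heps. destruct (qv_dense 1 (1 + eps)) as [ec Hec]; [lra|].
  exists (fun q => Some (fun m => decode_prog n m (code_list (prefix q (S (decode_at n m)))))).
  exists (fun p => Some (choice_functional n ec p)).
  split; [|split].
  - apply (computable_functional (decode_prog n) (decode_at n)).
    + apply recur_decode_prog.
    + unfold decode_at, level. auto 20 with recur.
  - apply (computable_functional (fun m c => choice_prog n ec (ent c) m)
      (fun m => 2 * fst (cunpair m))%nat).
    + apply recur_choice_prog.
    + auto 20 with recur.
  - intros G HG p [x A] [Hx HA] HAne. cbn [fst snd] in Hx, HA. cbn [eps_Proj mdom snd] in HAne.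
    destruct (HG (choice_functional n ec p) (choice_set n ec p)) as [q [Eq [r [Hq Hr]]]].
    + apply choice_functional_names.
    + exact (choice_set_complete eps n ec p x A Hx HA Hec HAne).
    + unfold pcomp. rewrite Eq. eexists. split; [reflexivity|].
      destruct (choice_set_sound eps n ec p x A Hx HA Hec r q HAne Hr Hq) as [y [Y1 Y2]].
      exists y. split; [exact Y1|exact Y2].
Qed.

Theorem theorem5p3 : forall (eps : R) (n : nat), 0 < eps -> (1 <= n)%nat ->
  sW_equiv (names_prod (names_Rn n) (names_An n)) (names_Rn n) (eps_Proj eps n)
           names_AR names_R C_R.
Proof.
  intros eps n Heps Hn. split.
  - now apply eps_Proj_le_C_R.
  - now apply C_R_le_eps_Proj.
Qed.
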